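(* Let $p$ be a prime and $\epsilon\in\mathbb{N}_0$. The theory $\operatorname{SDCF}^{\ell}_{p,\epsilon}$ has quantifier elimination.
   Context: Let $(K,\delta)$ be a differential field of characteristic $p$, $C_K$ its field of constants ($\delta$-kernel). A subset $A\subseteq K$ is differentially $p$-independent if $A\subseteq C_K$ and the $p$-monomials $a_1^{i_1}\cdots a_n^{i_n}$ ($a_j\in A$ distinct, $0\le i_j<p$) are linearly independent over $K^p$; it is a differential $p$-basis if moreover these monomials span $C_K$ over $K^p$. Fix $\epsilon\in\mathbb{N}_0$, put $s=p^\epsilon-1$ and fix an enumeration $m_0,\dots,m_s$ of the monomial functions $m(y_1,\dots,y_\epsilon)=y_1^{i_1}\cdots y_\epsilon^{i_\epsilon}$, $0\le i_j<p$. The language $\mathcal{L}_{\delta,\ell}$ is the language of differential fields $\{0,1,+,-,\cdot,{}^{-1},\delta\}$ together with constants $a_1,\dots,a_\epsilon$ and unary function symbols $\ell_0,\dots,\ell_s$. $\operatorname{DF}^{\ell}_{p,\epsilon}$ is the $\mathcal{L}_{\delta,\ell}$-theory of differential fields of characteristic $p$ with $[C_K:K^p]=p^\epsilon$ in which $\bar a=(a_1,\dots,a_\epsilon)$ is differentially $p$-independent and for all $b$: $\ell_i(b)=0$ for all $i$ if $b\notin C_K$, and $b=\sum_{i=0}^s\ell_i(b)^p m_i(\bar a)$ if $b\in C_K$. $\operatorname{SDCF}^{\ell}_{p,\epsilon}$ is $\operatorname{DF}^{\ell}_{p,\epsilon}$ together with the axioms stating that the field is separably differentially closed, i.e. for all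 nonzero $f,g\in K\{x\}$ with $f\notin K$, separant $s_f=\partial f/\partial x_{\operatorname{ord} f}\neq 0$ and $\operatorname{ord} g<\operatorname{ord} f$ there is $a\in K$ with $f(a)=0\neq g(a)$ (here $K\{x\}=K[x_0,x_1,\dots]$, $x_j=\delta^jx$, $\operatorname{ord}$ the largest index of a variable occurring). *)

(* Defs.v *)
From HB Require Import structures.
From mathcomp Require Import all_boot all_order all_algebra.
From mathcomp Require Import mpoly.

Set Implicit Arguments.
Unset Strict Implicit.
Unset Printing Implicit Defensive.

Import GRing.Theory.

(* First-order logic with equality, over signatures without relation symbols.
   A formula of type [formula S n] has its free variables among n variables
   (indexed by 'I_n); a quantifier binds the variable of index 0. *)

Record signature := Signature { fsym : Type; arity : fsym -> nat }.

Inductive term (S : signature) (n : nat) : Type :=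
| Var of 'I_n
| App (f : fsym S) of ('I_(arity f) -> term S n).

Inductive formula (S : signature) : nat -> Type :=
| FEq n of term S n & term S n : formula S n
| FFalse n : formula S n
| FAnd n of formula S n & formula S n : formula S n
| FOr n of formula S n & formula S n : formula S n
| FImp n of formula S n & formula S n : formula S n
| FAll n of formula S n.+1 : formula S n
| FEx n of formula S n.+1 : formula S n.

Record structure (S : signature) := Structure {
  carrier :> Type;
  interp : forall f : fsym S, ('I_(arity f) -> carrier) -> carrier }.

Fixpoint eval S (M : structure S) n (v : 'I_n -> M) (t : term S n) : M :=
  match t with
  | Var i => v i
  | App f ts => interp (fun i => eval v (ts i))
  end.

Definition scons (T : Type) n (x : T) (v : 'I_n -> T) (i : 'I_n.+1) : T :=
  if unlift ord0 i is Some j then v j else x.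

Fixpoint sat S (M : structure S) n (phi : formula S n) : ('I_n -> M) -> Prop :=
  match phi in formula _ n return ('I_n -> M) -> Prop with
  | FEq _ t u => fun v => eval v t = eval v u
  | FFalse _ => fun=> False
  | FAnd _ A B => fun v => sat A v /\ sat B v
  | FOr _ A B => fun v => sat A v \/ sat B v
  | FImp _ A B => fun v => sat A v -> sat B v
  | FAll _ A => fun v => forall x : M, sat A (scons x v)
  | FEx _ A => fun v => exists x : M, sat A (scons x v)
  end.

Fixpoint qfree S n (phi : formula S n) : bool :=
  match phi with
  | FEq _ _ _ | FFalse _ => true
  | FAnd _ A B | FOr _ A B | FImp _ A B => qfree A && qfree B
  | FAll _ _ | FEx _ _ => false
  end.

Definition sentence S := formula S 0.
Definition theory S := sentence S -> Prop.

Definition holds S (M : structure S) (phi : sentence S) : Prop :=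
  forall v : 'I_0 -> M, sat phi v.

Definition is_model S (M : structure S) (T : theory S) : Prop :=
  forall phi, T phi -> holds M phi.

Definition equiv_mod S (T : theory S) n (phi psi : formula S n) : Prop :=
  forall M : structure S, is_model M T ->
  forall v : 'I_n -> M, sat phi v <-> sat psi v.

Definition has_QE S (T : theory S) : Prop :=
  forall n (phi : formula S n),
  exists psi : formula S n, qfree psi /\ equiv_mod T phi psi.

(* The language of differential fields with constants a_1, ..., a_eps and
   functions l_0, ..., l_s, where s = p ^ eps - 1. *)

Inductive Lsym (p eps : nat) : Type :=
| SZero | SOne | SAdd | SOpp | SMul | SInv | SDelta
| SConst of 'I_eps
| SEll of 'I_(p ^ eps).

Definition Larity p eps (f : Lsym p eps) : nat :=
  match f with
  | SZero | SOne | SConst _ => 0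
  | SOpp | SInv | SDelta | SEll _ => 1
  | SAdd | SMul => 2
  end.

Definition Ldl (p eps : nat) : signature := Signature (@Larity p eps).

Local Open Scope ring_scope.

(* The symbol for inversion is interpreted with the convention 0^-1 = 0. *)
Definition Ldl_structure p eps (K : fieldType) (delta : K -> K)
    (a : 'I_eps -> K) (l : 'I_(p ^ eps) -> K -> K) : structure (Ldl p eps) :=
  @Structure (Ldl p eps) K (fun f =>
    match f return ('I_(@Larity p eps f) -> K) -> K with
    | SZero => fun=> 0
    | SOne => fun=> 1
    | SAdd => fun x => x ord0 + x ord_max
    | SOpp => fun x => - x ord0
    | SMul => fun x => x ord0 * x ord_max
    | SInv => fun x => (x ord0)^-1
    | SDelta => fun x => delta (x ord0)
    | SConst j => fun=> a j
    | SEll i => fun x => l i (x ord0)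
    end).

Section DifferentialFields.

Variable K : fieldType.

Definition is_derivation (delta : K -> K) : Prop :=
  (forall x y, delta (x + y) = delta x + delta y) /\
  (forall x y, delta (x * y) = delta x * y + x * delta y).

Definition constant (delta : K -> K) (x : K) : Prop := delta x = 0.

Definition pth_power (p : nat) (x : K) : Prop := exists y : K, x = y ^+ p.

Definition lin_indep_over (F : K -> Prop) (I : finType) (v : I -> K) : Prop :=
  forall c : I -> K, (forall i, F (c i)) ->
  \sum_i c i * v i = 0 -> forall i, c i = 0.

Definition spans_over (F V : K -> Prop) (I : finType) (v : I -> K) : Prop :=
  forall x, V x -> exists2 c : I -> K,
    forall i, F (c i) & x = \sum_i c i * v i.

(* For subfields F <= V of K: [V : F] = d. *)
Definition has_degree (V F : K -> Prop) (d : nat) : Prop :=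
  exists v : 'I_d -> K,
    [/\ forall i, V (v i), lin_indep_over F v & spans_over F V v].

Definition pmonomial (p eps : nat) (a : 'I_eps -> K)
    (e : {ffun 'I_eps -> 'I_p}) : K :=
  \prod_(j < eps) a j ^+ e j.

Definition diff_p_independent (p eps : nat) (delta : K -> K)
    (a : 'I_eps -> K) : Prop :=
  (forall j, constant delta (a j)) /\
  lin_indep_over (pth_power p) (@pmonomial p eps a).

(* K{x} is the union over N of the rings K[x_0, ..., x_(N-1)]. *)

Definition occurs N (f : {mpoly K[N]}) (i : 'I_N) : Prop :=
  exists2 m : 'X_{1..N}, m \in msupp f & m i != 0%N.

(* Elements of K have no order in this sense. *)
Definition is_order N (f : {mpoly K[N]}) (n : 'I_N) : Prop :=
  occurs f n /\ forall j, occurs f j -> (j <= n)%N.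

(* ord f < n, where elements of K have order -oo. *)
Definition order_lt N (f : {mpoly K[N]}) (n : 'I_N) : Prop :=
  forall j, occurs f j -> (j < n)%N.

Definition deval (delta : K -> K) N (f : {mpoly K[N]}) (x : K) : K :=
  f.@[fun i : 'I_N => iter i delta x].

(* The condition f \notin K amounts to the existence of the order n of f. *)
Definition separably_diff_closed (delta : K -> K) : Prop :=
  forall N (f g : {mpoly K[N]}) (n : 'I_N),
    f != 0 -> g != 0 -> is_order f n -> f^`M(n) != 0 -> order_lt g n ->
    exists x : K, deval delta f x = 0 /\ deval delta g x != 0.

(* mu enumerates the exponents of the monomials m_0, ..., m_s. *)
Definition is_DFl (p eps : nat) (mu : 'I_(p ^ eps) -> {ffun 'I_eps -> 'I_p})
    (delta : K -> K) (a : 'I_eps -> K) (l : 'I_(p ^ eps) -> K -> K) : Prop :=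
  [/\ is_derivation delta,
      p \in [pchar K],
      has_degree (constant delta) (pth_power p) (p ^ eps),
      diff_p_independent p delta a &
      forall b : K,
        (~ constant delta b -> forall i, l i b = 0) /\
        (constant delta b -> b = \sum_i l i b ^+ p * pmonomial a (mu i))].

End DifferentialFields.

Definition SDCFl (p eps : nat) (mu : 'I_(p ^ eps) -> {ffun 'I_eps -> 'I_p}) :
    theory (Ldl p eps) :=
  fun phi => forall (K : fieldType) (delta : K -> K) (a : 'I_eps -> K)
    (l : 'I_(p ^ eps) -> K -> K),
  is_DFl mu delta a l -> separably_diff_closed delta ->
  holds (Ldl_structure delta a l) phi.

(* Main.v *)
From HB Require Import structures.
From Stdlib Require List.
From mathcomp Require Import all_boot all_order all_algebra.
From mathcomp Require Import boolp mpoly ring zify.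
From mathcomp Require filter.
Require Import Defs.

(** The theory consists of all sentences true in the structures (K, delta, a, l)
    satisfying the axioms, so it suffices to find quantifier-free equivalents in
    these. By compactness (ultraproducts) one
    has to show: if tuples v in K and w in L satisfy the same quantifier-free
    formulas and K satisfies theta(x, v), then L has a solution of theta(_, w).

    The values of terms at v and w form the graph G of an isomorphism of
    differential fields A = dom G -> A', and A is closed under the functions l_i.
    It suffices to extend G, inside elementary extensions of K and L, to finitely
    many given elements of K, because b = sum_i l_i(b)^p m_i(a) determines the
    l_i(b). Adjoining to A a differentially transcendental element keeps it closed
    under the l_i. If A is closed under the l_i, then every x in K is either
    differentially transcendental over A or satisfies a separable equation over
    A(x, ..., delta^(n-1) x) for the least n making delta^n x algebraic: if the
    minimal polynomial were f(X^p), then applying delta shows that its coefficients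
    are constants, hence f(X^p) = sum_i m_i(a) h_i^p, against minimality. In both
    cases x can be adjoined, by separable differential closedness of L.

    After a separable step A need no longer be closed under the l_i, so several
    elements are treated at once by a differential primitive element u = x + t y,
    where t is differentially transcendental over K: the derivation d/d(delta^n t)
    kills delta^j u for j < n and sends delta^n u to y, so applying it to a
    separable equation of order n for u expresses y through t and u. *)

Set Implicit Arguments.
Unset Strict Implicit.
Unset Printing Implicit Defensive.

Import GRing.Theory.
Local Open Scope ring_scope.

(** * Subfields, simple extensions and derivations *)

Section Subfields.

Variable R : comUnitRingType.
Implicit Types (F : R -> Prop) (x y e : R) (P Q f : {poly R}).

(** The ambient ring is allowed zero divisors, because products $K \times L$ of two fields serve
    later as ambient rings. Hence [sfU]: nonzero elements must be units of the whole ring. *)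
Record is_subfield F : Prop := IsSubfield {
  sf1 : F 1;
  sfB : forall x y, F x -> F y -> F (x - y);
  sfM : forall x y, F x -> F y -> F (x * y);
  sfV : forall x, F x -> F x^-1;
  sfU : forall x, F x -> x != 0 -> x \is a GRing.unit }.

Section Closure.

Variable F : R -> Prop.
Hypothesis hF : is_subfield F.

Lemma sf0 : F 0.
Proof. by rewrite -(subrr 1); apply: sfB => //; apply: sf1. Qed.

Lemma sfN x : F x -> F (- x).
Proof. by move=> Fx; rewrite -sub0r; apply: sfB => //; apply: sf0. Qed.

Lemma sfD x y : F x -> F y -> F (x + y).
Proof. by move=> Fx Fy; rewrite -[y]opprK; apply: sfB => //; apply: sfN. Qed.

Lemma sfX x n : F x -> F (x ^+ n).
Proof.
move=> Fx; elim: n => [|n IHn]; first by rewrite expr0; apply: sf1.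
by rewrite exprS; apply: sfM.
Qed.

Lemma sf_sum (I : Type) (r : seq I) (p : pred I) (E : I -> R) :
  (forall i, p i -> F (E i)) -> F (\sum_(i <- r | p i) E i).
Proof. by move=> FE; apply: big_ind => //; [exact: sf0|exact: sfD]. Qed.

Lemma sf_prod (I : Type) (r : seq I) (p : pred I) (E : I -> R) :
  (forall i, p i -> F (E i)) -> F (\prod_(i <- r | p i) E i).
Proof. by move=> FE; apply: big_ind => //; [exact: sf1 hF|exact: sfM]. Qed.

Lemma sfMn x n : F x -> F (x *+ n).
Proof.
move=> Fx; elim: n => [|n IHn]; first by rewrite mulr0n; apply: sf0.
by rewrite mulrS; apply: sfD.
Qed.

End Closure.

Definition poly_over F P := forall i, F P`_i.

Section PolyClosure.

Variable F : R -> Prop.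
Hypothesis hF : is_subfield F.

Lemma poverC c : F c -> poly_over F c%:P.
Proof. by move=> Fc i; rewrite coefC; case: ifP => // _; apply: sf0. Qed.

Lemma poverX : poly_over F 'X.
Proof.
by move=> i; rewrite coefX; case: eqP => _; [apply: sf1|apply: sf0].
Qed.

Lemma poverD P Q : poly_over F P -> poly_over F Q -> poly_over F (P + Q).
Proof. by move=> FP FQ i; rewrite coefD; apply: sfD. Qed.

Lemma poverB P Q : poly_over F P -> poly_over F Q -> poly_over F (P - Q).
Proof. by move=> FP FQ i; rewrite coefB; apply: sfB. Qed.

Lemma poverM P Q : poly_over F P -> poly_over F Q -> poly_over F (P * Q).
Proof.
by move=> FP FQ i; rewrite coefM; apply: sf_sum => // j _; apply: sfM.
Qed.

Lemma poverX_n P n : poly_over F P -> poly_over F (P ^+ n).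
Proof.
move=> FP; elim: n => [|n IHn]; last by rewrite exprS; apply: poverM.
by rewrite expr0; apply: poverC; apply: sf1.
Qed.

Lemma poverZ c P : F c -> poly_over F P -> poly_over F (c *: P).
Proof. by move=> Fc FP i; rewrite coefZ; apply: sfM. Qed.

Lemma pover_deriv P : poly_over F P -> poly_over F P^`().
Proof. by move=> FP i; rewrite coef_deriv; apply: sfMn. Qed.

Lemma pover_horner P x : poly_over F P -> F x -> F P.[x].
Proof.
move=> FP Fx; rewrite horner_coef; apply: sf_sum => // i _.
by apply: sfM => //; apply: sfX.
Qed.

Lemma poly_over_sub (F' : R -> Prop) P :
  (forall x, F x -> F' x) -> poly_over F P -> poly_over F' P.
Proof. by move=> sub FP i; apply: sub. Qed.

End PolyClosure.

(* [adj F x] is F(x): the equation [e * Q.[x] = P.[x]] says e = P(x) / Q(x). *)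
Definition adj F x e := exists P Q,
  [/\ poly_over F P, poly_over F Q, Q.[x] \is a GRing.unit & e * Q.[x] = P.[x]].

(** This is the condition under which the fractions P(x)/Q(x) form a field inside a ring with zero
    divisors. It is automatic in a field. *)
Definition unital_at F x :=
  forall P, poly_over F P -> P.[x] = 0 \/ P.[x] \is a GRing.unit.

Section Adjunction.

Variables (F : R -> Prop) (x : R).
Hypothesis hF : is_subfield F.

Lemma adj_horner P : poly_over F P -> adj F x P.[x].
Proof.
move=> FP; exists P, 1%:P; split => //; first by apply: poverC => //; apply: sf1.
  by rewrite hornerC unitr1.
by rewrite hornerC mulr1.
Qed.

Lemma adj_base c : F c -> adj F x c.
Proof. by move=> Fc; rewrite -(hornerC c x); apply: adj_horner; apply: poverC. Qed.

Lemma adj_gen : adj F x x.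
Proof. by rewrite -{2}(hornerX x); apply: adj_horner; apply: poverX. Qed.

Lemma adj_min (F' : R -> Prop) : is_subfield F' ->
  (forall c, F c -> F' c) -> F' x -> forall e, adj F x e -> F' e.
Proof.
move=> hF' sub F'x e [P [Q [FP FQ uQ E]]].
have -> : e = P.[x] * Q.[x]^-1 by rewrite -E mulrK.
by apply: sfM => //; [|apply: sfV => //]; apply: pover_horner => // i; apply: sub.
Qed.

Lemma adj_subfield : unital_at F x -> is_subfield (adj F x).
Proof.
move=> hx; split.
- by apply: adj_base; apply: sf1.
- move=> e1 e2 [P1 [Q1 [FP1 FQ1 u1 E1]]] [P2 [Q2 [FP2 FQ2 u2 E2]]].
  exists (P1 * Q2 - P2 * Q1), (Q1 * Q2); split.
  + by apply: poverB => //; apply: poverM.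
  + exact: poverM.
  + by rewrite hornerM unitrM u1.
  + by rewrite hornerD hornerN !hornerM -E1 -E2; ring.
- move=> e1 e2 [P1 [Q1 [FP1 FQ1 u1 E1]]] [P2 [Q2 [FP2 FQ2 u2 E2]]].
  exists (P1 * P2), (Q1 * Q2); split; try exact: poverM.
  + by rewrite hornerM unitrM u1.
  + by rewrite !hornerM -E1 -E2; ring.
- move=> e [P [Q [FP FQ uQ E]]]; case: (hx P FP) => [P0|uP].
    have -> : e = 0 by rewrite -[e](mulrK uQ) E P0 mul0r.
    by rewrite invr0; apply: adj_base; apply: sf0.
  exists Q, P; split=> //.
  have ue : e \is a GRing.unit by move: uP; rewrite -E unitrM => /andP[].
  by rewrite -E mulKr.
- move=> e [P [Q [FP FQ uQ E]]] e0; case: (hx P FP) => [P0|uP].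
    by move: e0; rewrite -[e](mulrK uQ) E P0 mul0r eqxx.
  by move: uP; rewrite -E unitrM => /andP[].
Qed.

End Adjunction.

(** The index counts the adjoined generators: this is $F(x_0, \dots, x_{n-1})$, built one simple
    extension at a time. *)
Fixpoint chain F (x : nat -> R) n : R -> Prop :=
  if n is k.+1 then adj (chain F x k) (x k) else F.

Definition chain_union F (x : nat -> R) e := exists n, chain F x n e.

Lemma chain_subfield F (x : nat -> R) n : is_subfield F ->
  (forall i, (i < n)%N -> unital_at (chain F x i) (x i)) ->
  is_subfield (chain F x n).
Proof.
move=> hF; elim: n => [//|n IHn] hx /=.
apply: adj_subfield; last exact: hx.
by apply: IHn => i lt_in; apply: hx; apply: ltnW.
Qed.

Lemma chain_mono F (x : nat -> R) m n e : is_subfield F ->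
  (forall i, (i < n)%N -> unital_at (chain F x i) (x i)) ->
  (m <= n)%N -> chain F x m e -> chain F x n e.
Proof.
move=> hF; elim: n => [|n IHn] hx; first by case: m.
rewrite leq_eqVlt => /orP[/eqP-> //|]; rewrite ltnS => le_mn Fe.
have hx' i : (i < n)%N -> unital_at (chain F x i) (x i).
  by move=> lt_in; apply: hx; apply: ltnW.
by apply: adj_base; [apply: chain_subfield|apply: IHn].
Qed.

Lemma chain_gen F (x : nat -> R) i n : is_subfield F ->
  (forall i, (i < n)%N -> unital_at (chain F x i) (x i)) ->
  (i < n)%N -> chain F x n (x i).
Proof.
move=> hF hx lt_in; apply: (@chain_mono F x i.+1) => //=.
apply: adj_gen; apply: chain_subfield => // j lt_ji.
by apply: hx; apply: ltn_trans lt_in.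
Qed.

Lemma chain_min F (F' : R -> Prop) (x : nat -> R) n : is_subfield F' ->
  (forall c, F c -> F' c) -> (forall i, (i < n)%N -> F' (x i)) ->
  forall e, chain F x n e -> F' e.
Proof.
move=> hF' sub; elim: n => [//|n IHn] F'x e /=.
apply: adj_min => //; last exact: F'x.
by apply: IHn => i lt_in; apply: F'x; apply: ltnW.
Qed.

Lemma chain_union_subfield F (x : nat -> R) : is_subfield F ->
  (forall i, unital_at (chain F x i) (x i)) ->
  is_subfield (chain_union F x).
Proof.
move=> hF hx.
have hC n : is_subfield (chain F x n) by apply: chain_subfield.
have mono m n e : (m <= n)%N -> chain F x m e -> chain F x n e.
  by move=> ?; apply: chain_mono.
split.
- by exists 0%N; apply: sf1 hF.
- move=> e1 e2 [m H1] [n H2]; exists (maxn m n).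
  by apply: sfB => //; [apply: mono H1|apply: mono H2]; rewrite leq_max leqnn ?orbT.
- move=> e1 e2 [m H1] [n H2]; exists (maxn m n).
  by apply: sfM => //; [apply: mono H1|apply: mono H2]; rewrite leq_max leqnn ?orbT.
- by move=> e [n H]; exists n; apply: sfV.
- by move=> e [n H]; apply: sfU H.
Qed.

(** Euclidean division that keeps track of the coefficient field. Each round cancels the leading
    term of P; a monic divisor makes this possible over any ring. *)
Lemma pover_divmod F f P : is_subfield F -> f \is monic ->
  poly_over F f -> poly_over F P -> exists q r,
  [/\ poly_over F q, poly_over F r, P = q * f + r & (size r < size f)%N].
Proof.
move=> hF mf Ff; have [k] := ubnP (size P); elim: k P => // k IHk P.
rewrite ltnS => le_Pk FP; case: (ltnP (size P) (size f)) => [lt|le_fP].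
  exists 0, P; split=> //; last by rewrite mul0r add0r.
  by apply: (@poverC _ hF 0); apply: sf0.
have f0 : (0 < size f)%N by rewrite size_poly_gt0 monic_neq0.
have P0 : (0 < size P)%N by apply: leq_trans le_fP.
pose c := lead_coef P; pose d := (size P - size f)%N.
pose P' := P - c *: ('X^d * f).
have Fc : F c by apply: FP.
have FM : poly_over F (c *: ('X^d * f)).
  by apply: poverZ => //; apply: poverM => //; apply: poverX_n => //; apply: poverX.
have lt_P' : (size P' < size P)%N.
  rewrite -(prednK P0) ltnS; apply/leq_sizeP => j le_j.
  rewrite coefB coefZ coefXnM.
  have ltd : (j < d)%N = false.
    apply/negbTE; rewrite -leqNgt (leq_trans _ le_j) // /d; clear -f0 P0; lia.
  rewrite ltd; move: le_j; rewrite leq_eqVlt => /orP[/eqP <-|lt_j].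
    have -> : ((size P).-1 - d = (size f).-1)%N by rewrite /d; clear -f0 P0 le_fP; lia.
    by move/eqP: mf; rewrite /lead_coef => ->; rewrite mulr1 subrr.
  have le1 : (size P <= j)%N by clear -P0 lt_j; lia.
  have le2 : (size f <= j - d)%N by rewrite /d; clear -f0 le1 le_fP; lia.
  by rewrite (nth_default _ le1) (nth_default _ le2) mulr0 subrr.
have [q [r [Fq Fr E ltr]]] := IHk P' (leq_trans lt_P' le_Pk) (poverB hF FP FM).
exists (q + c *: 'X^d), r; split=> //.
  by apply: poverD => //; apply: poverZ => //; apply: poverX_n => //; apply: poverX.
by rewrite mulrDl addrAC -E /P' -scalerAl subrK.
Qed.

(* If f has minimal degree among the polynomials over F whose value at x lies in
   the kernel of h, and f(x) = 0, then F[x] is a field by Bezout. *)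
Lemma minimal_unital (K : fieldType) (h : {rmorphism R -> K}) F x f :
  is_subfield F -> f \is monic -> poly_over F f -> f.[x] = 0 ->
  (forall P, poly_over F P -> P != 0 -> h P.[x] = 0 -> (size f <= size P)%N) ->
  unital_at F x.
Proof.
move=> hF mf Ff f0 minf.
(* Induction on the size of r, normalised to the monic [r1], by dividing f = q r1 + s. If s is
   nonzero, then s(x) = - q(x) r1(x) is a unit by induction, hence so is r1(x). If s = 0, then [h]
   kills q(x) or r1(x), against minimality unless r1 = 1. *)
have red k (r : {poly R}) : (size r < k)%N -> r != 0 -> (size r < size f)%N -> poly_over F r ->
    r.[x] \is a GRing.unit.
  elim: k r => // k IHk r lek r0 ltrf Fr.
  have Fl : F (lead_coef r) by apply: Fr.
  have ul : lead_coef r \is a GRing.unit by apply: (sfU hF) => //; rewrite lead_coef_eq0.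
  pose r1 := (lead_coef r)^-1 *: r.
  have Fr1 : poly_over F r1 by apply: poverZ => //; apply: sfV.
  have sr1 : size r1 = size r.
    by rewrite lreg_size //; apply: mulrI; rewrite unitrV.
  have mr1 : r1 \is monic.
    by rewrite monicE /lead_coef sr1 coefZ -/(lead_coef r) mulVr.
  have [q [s [Fq Fs E lts]]] := pover_divmod hF mr1 Fr1 Ff.
  have rE : r.[x] = lead_coef r * r1.[x] by rewrite hornerZ mulVKr.
  rewrite rE unitrM ul /=.
  have [s0|s0] := eqVneq s 0; last first.
    have us : s.[x] \is a GRing.unit.
      apply: IHk => //; first by rewrite -ltnS; apply: leq_trans lek; rewrite ltnS -sr1.
      by apply: ltn_trans lts _; rewrite sr1.
    move: f0; rewrite E hornerD hornerM => /eqP; rewrite addrC addr_eq0 => /eqP Es.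
    by move: us; rewrite Es unitrN unitrM => /andP[].
  have [q1|nq1] := leqP (size r1) 1.
    have: r1 = 1.
      have r10 : r1 != 0 by apply: monic_neq0.
      have sz1 : size r1 = 1%N by apply/eqP; rewrite eqn_leq q1 size_poly_gt0.
      rewrite [r1]size1_polyC; last by rewrite sz1.
      by move/eqP: mr1; rewrite /lead_coef sz1 /= => ->.
    by move=> ->; rewrite hornerC unitr1.
  have fq : f = q * r1 by rewrite E s0 addr0.
  have f1 : f != 0 by apply: monic_neq0.
  have q0 : q != 0 by apply: contraNneq f1 => q0; rewrite fq q0 mul0r.
  have szf : size f = (size q + size r1).-1 by rewrite fq size_Mmonic.
  have := f0; rewrite fq hornerM => /(congr1 h); rewrite rmorphM rmorph0 => /eqP.
  rewrite mulf_eq0 => /orP[] /eqP hz.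
    by have := minf q Fq q0 hz; rewrite szf; move: nq1; lia.
  have := minf r1 Fr1 (monic_neq0 mr1) hz.
  by rewrite sr1; move: ltrf; lia.
move=> P FP; have [q [r [Fq Fr E ltr]]] := pover_divmod hF mf Ff FP.
have -> : P.[x] = r.[x] by rewrite E hornerD hornerM f0 mulr0 add0r.
have [->|r0] := eqVneq r 0; first by left; rewrite horner0.
by right; apply: (red (size r).+1).
Qed.

End Subfields.

Lemma unital_field (K : fieldType) (F : K -> Prop) x : unital_at F x.
Proof.
move=> P _; have [->|n0] := eqVneq P.[x] 0; first by left.
by right; rewrite unitfE.
Qed.

Lemma horner_deriv (R : comNzRingType) (P : {poly R}) n x : (size P <= n)%N ->
  P^`().[x] = \sum_(i < n) P`_i * (x ^+ i.-1 *+ i).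
Proof.
move=> le; rewrite (@horner_coef_wide _ n.-1); last first.
  by apply: leq_trans (size_poly _ _) _; move: le; case: (size P) n => [|k] [].
case: n le => [|n] _ /=; first by rewrite !big_ord0.
rewrite [RHS]big_ord_recl /= mulr0n mulr0 add0r.
by apply: eq_bigr => i _; rewrite coef_deriv /= mulrnAl mulrnAr.
Qed.

(** * Derivations on iterated extensions *)

Section Derivations.

Variables (R : comUnitRingType) (d : R -> R).
Hypothesis dD : forall x y, d (x + y) = d x + d y.
Hypothesis dM : forall x y, d (x * y) = d x * y + x * d y.

Lemma der0 : d 0 = 0.
Proof. by apply: (addrI (d 0)); rewrite -dD !addr0. Qed.

Lemma der1 : d 1 = 0.
Proof. by apply: (addrI (d 1)); rewrite -{1}[d 1]mulr1 -{2}[d 1]mul1r -dM mulr1 addr0. Qed.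

Lemma der_sum (I : Type) (r : seq I) (p : pred I) (E : I -> R) :
  d (\sum_(i <- r | p i) E i) = \sum_(i <- r | p i) d (E i).
Proof. by apply: (big_morph d dD der0). Qed.

Lemma derX x n : d (x ^+ n) = x ^+ n.-1 * d x *+ n.
Proof.
elim: n => [|[|n] IHn]; first by rewrite expr0 der1 mulr0n.
  by rewrite expr1 expr0 mul1r.
rewrite exprS dM IHn /= mulrnAr mulrA -exprS [in RHS]mulrS [d x * _]mulrC.
by [].
Qed.

(** The Leibniz rule splits into the part where [d] hits the coefficients and the part where it hits
    x. All separability arguments below rest on this identity. *)
Lemma der_horner (P : {poly R}) x :
  d P.[x] = (map_poly d P).[x] + P^`().[x] * d x.
Proof.
rewrite (horner_coef P) der_sum.
have -> : (map_poly d P).[x] = \sum_(i < size P) d P`_i * x ^+ i.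
  rewrite (@horner_coef_wide _ (size P)); last exact: size_poly.
  by apply: eq_bigr => i _; rewrite coef_map_id0 ?der0.
rewrite (horner_deriv _ (leqnn (size P))).
rewrite mulr_suml -big_split /=; apply: eq_bigr => i _.
by rewrite dM derX !mulrnAr mulrnAl mulrA.
Qed.

(** The quotient rule. A second field [F'] is allowed because the derivation may lead out of
    F(x). *)
Lemma der_adj (F F' : R -> Prop) x e : is_subfield F' ->
  (forall c, F c -> F' c) -> (forall c, F c -> F' (d c)) -> F' x -> F' (d x) ->
  adj F x e -> F' (d e).
Proof.
move=> hF' sub dsub F'x F'dx [P [Q [FP FQ uQ E]]].
have H (T : {poly R}) : poly_over F T -> F' T.[x] /\ F' (d T.[x]).
  move=> FT; split; first by apply: pover_horner => //; apply: poly_over_sub FT.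
  rewrite der_horner; apply: sfD => //.
    apply: pover_horner => // i; rewrite coef_map_id0 ?der0 //.
    exact: dsub.
  apply: sfM => //; apply: pover_horner => //; apply: pover_deriv => //.
  exact: poly_over_sub FT.
have [FPx FdPx] := H _ FP; have [FQx FdQx] := H _ FQ.
have F'e : F' e by rewrite -[e](mulrK uQ) E; apply: sfM => //; apply: sfV.
have -> : d e = (d P.[x] - e * d Q.[x]) * Q.[x]^-1 by rewrite -E dM addrK mulrK.
by apply: sfM => //; [apply: sfB => //; apply: sfM|apply: sfV].
Qed.

Section Prolongation.

Variables (F : R -> Prop) (x : nat -> R).
Hypothesis hF : is_subfield F.
Hypothesis dF : forall c, F c -> F (d c).
Hypothesis dx : forall i, d (x i) = x i.+1.

Lemma chain_der n e :
  (forall i, (i <= n)%N -> unital_at (chain F x i) (x i)) ->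
  chain F x n e -> chain F x n.+1 (d e).
Proof.
elim: n e => [|n IHn] e hx Fe.
  by apply: adj_base => //; apply: dF.
have hC : is_subfield (chain F x n.+2) by apply: chain_subfield.
move: Fe; apply: der_adj => //.
- by move=> c; apply: (@chain_mono _ F x n n.+2) => //; apply: leqW.
- move=> c Fc; have := IHn c (fun i h => hx i (leqW h)) Fc.
  exact: (@chain_mono _ F x n.+1 n.+2).
- by apply: chain_gen => //; rewrite ltnS leqnSn.
- by rewrite dx; apply: chain_gen.
Qed.

(** Only the last generator $x_{n-1}$ has its derivative $x_n$ outside the chain by construction,
    and it enters linearly. When d e = 0 both coefficients are chosen to be 0, which is not
    automatic if $x_n$ lies in the chain. *)
Lemma chain_der_affine n e :
  (forall i, (i < n)%N -> unital_at (chain F x i) (x i)) ->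
  chain F x n e -> exists al be,
  [/\ chain F x n al, chain F x n be, d e = al + be * x n &
      d e = 0 -> al = 0 /\ be = 0].
Proof.
move=> hx Fe; have hC : is_subfield (chain F x n) by apply: chain_subfield.
have [de0|nde0] := eqVneq (d e) 0.
  by exists 0, 0; split; rewrite ?mul0r ?addr0 //; apply: sf0.
suff [al [be [Fal Fbe E]]] : exists al be,
    [/\ chain F x n al, chain F x n be & d e = al + be * x n].
  by exists al, be; split=> // /eqP; rewrite (negbTE nde0).
case: n hx Fe hC => [|n] hx Fe hC.
  by exists (d e), 0; rewrite mul0r addr0; split=> //; [apply: dF|apply: sf0].
case: Fe => [P [Q [FP FQ uQ E]]].
have H (T : {poly R}) : poly_over (chain F x n) T ->
    [/\ chain F x n.+1 T.[x n], chain F x n.+1 (map_poly d T).[x n] &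
        chain F x n.+1 T^`().[x n]].
  move=> FT; have Fx : chain F x n.+1 (x n) by apply: chain_gen.
  have sub c : chain F x n c -> chain F x n.+1 c by apply: (@chain_mono _ F x n n.+1).
  split; first by apply: pover_horner => //; apply: poly_over_sub FT.
    apply: pover_horner => // i; rewrite coef_map_id0 ?der0 //.
    exact: (chain_der hx).
  apply: pover_horner => //; apply: pover_deriv => //.
  exact: poly_over_sub FT.
have [H1 H2 H3] := H _ FP; have [H4 H5 H6] := H _ FQ.
have Fe : chain F x n.+1 e by rewrite -[e](mulrK uQ) E; apply: sfM => //; apply: sfV.
exists (((map_poly d P).[x n] - e * (map_poly d Q).[x n]) * Q.[x n]^-1).
exists ((P^`().[x n] - e * Q^`().[x n]) * Q.[x n]^-1); split.
- by apply: sfM => //; [apply: sfB => //; apply: sfM|apply: sfV].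
- by apply: sfM => //; [apply: sfB => //; apply: sfM|apply: sfV].
have -> : d e = (d P.[x n] - e * d Q.[x n]) * Q.[x n]^-1 by rewrite -E dM addrK mulrK.
by rewrite !der_horner dx; ring.
Qed.

Lemma chain_union_der e : (forall i, unital_at (chain F x i) (x i)) ->
  chain_union F x e -> chain_union F x (d e).
Proof. by move=> hx [n Fe]; exists n.+1; apply: chain_der. Qed.

(* A separable equation for x_n expresses x_(n+1) rationally. *)
Lemma chain_der_sep n (f : {poly R}) :
  (forall i, (i <= n)%N -> unital_at (chain F x i) (x i)) ->
  poly_over (chain F x n) f -> f.[x n] = 0 -> f^`().[x n] \is a GRing.unit ->
  forall e, chain F x n.+1 e -> chain F x n.+1 (d e).
Proof.
move=> hx Ff f0 uf e.
have hC : is_subfield (chain F x n.+1) by apply: chain_subfield.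
have hCn : is_subfield (chain F x n).
  by apply: chain_subfield => // i lt; apply: hx; apply: ltnW.
have sub c : chain F x n c -> chain F x n.+1 c by apply: adj_base.
have hx' i : (i < n.+1)%N -> unital_at (chain F x i) (x i) by apply: hx.
apply: der_adj => //.
- by move=> c; apply: chain_der.
- exact: adj_gen.
have := der_horner f (x n); rewrite f0 der0 => /esym/eqP.
rewrite addrC addr_eq0 => /eqP E.
have -> : d (x n) = f^`().[x n]^-1 * - (map_poly d f).[x n] by rewrite -E mulKr.
have Fx : chain F x n.+1 (x n) by apply: adj_gen.
apply: sfM => //.
  apply: sfV => //; apply: pover_horner => //; apply: pover_deriv => //.
  exact: poly_over_sub Ff.
apply: sfN => //; apply: pover_horner => // i; rewrite coef_map_id0 ?der0 //.
by apply: chain_der.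
Qed.

End Prolongation.

End Derivations.

(** * Constants, p-th powers and separability *)

Lemma ex_minimal (P : nat -> Prop) : (exists n, P n) ->
  exists n, P n /\ forall m, P m -> (n <= m)%N.
Proof.
move=> exP; have exb : exists n, `[< P n >] by case: exP => n Pn; exists n; apply/asboolP.
case: (ex_minnP exb) => n /asboolP Pn minn; exists n; split=> // m Pm.
by apply: minn; apply/asboolP.
Qed.

Definition transc (K : fieldType) (F : K -> Prop) (x : K) :=
  forall P : {poly K}, poly_over F P -> P.[x] = 0 -> P = 0.

Lemma transc_notin (K : fieldType) (F : K -> Prop) (x : K) :
  is_subfield F -> transc F x -> ~ F x.
Proof.
move=> hF tx Fx; have := tx ('X - x%:P) _ _.
rewrite !hornerE subrr => h; have /eqP := h (poverB hF (poverX hF) (poverC hF Fx)) erefl.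
by rewrite polyXsubC_eq0.
Qed.

Section PthPowers.

Variables (K : fieldType) (d : K -> K) (p : nat).
Hypothesis dD : forall x y, d (x + y) = d x + d y.
Hypothesis dM : forall x y, d (x * y) = d x * y + x * d y.
Hypothesis pK : p \in [pchar K].
Variables (I : finType) (m : I -> K).

Let p_pr : prime p. Proof. exact: pcharf_prime pK. Qed.

(** The set $\sum_i F^p m_i$. With the p-monomials for m, a constant lies in it exactly when its
    coordinates, the p-th roots of the coefficients, can be taken in F. *)
Definition pspan (F : K -> Prop) (e : K) :=
  exists2 h : I -> K, forall i, F (h i) & e = \sum_i h i ^+ p * m i.

Lemma der_pth x : d (x ^+ p) = 0.
Proof. by rewrite (derX dM) -mulr_natr (pcharf0 pK) mulr0. Qed.

Lemma pth_sum (J : Type) (r : seq J) (P : pred J) (E : J -> K) :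
  (\sum_(j <- r | P j) E j) ^+ p = \sum_(j <- r | P j) E j ^+ p.
Proof. exact: (rmorph_sum (pFrobenius_aut pK)). Qed.

Lemma deriv0_coef (f : {poly K}) j : f^`() = 0 -> ~~ (p %| j)%N -> f`_j = 0.
Proof.
case: j => [|j]; first by rewrite dvdn0.
move=> f0; rewrite (dvdn_pcharf pK) => nz; have := congr1 (fun q : {poly K} => q`_j) f0.
by rewrite coef_deriv coef0 -mulr_natr => /eqP; rewrite mulf_eq0 (negbTE nz) orbF => /eqP.
Qed.

(** As f' = 0, both families are supported on multiples of p. The terms of the first sum then have
    degrees divisible by p and those of the second have degrees congruent to 1, so nothing can
    cancel. *)
Lemma spread (f : {poly K}) (al be : nat -> K) : f^`() = 0 ->
  (forall j, f`_j = 0 -> al j = 0 /\ be j = 0) ->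
  \poly_(j < size f) al j + \poly_(j < size f) be j * 'X = 0 ->
  forall j, al j = 0 /\ be j = 0.
Proof.
move=> f'0 h0 E; set n := size f in E.
have offp j : ~~ (p %| j)%N -> al j = 0 /\ be j = 0.
  by move=> nd; apply: h0; apply: deriv0_coef.
have big j : (n <= j)%N -> al j = 0 /\ be j = 0.
  by move=> le; apply: h0; rewrite nth_default.
have cA j : (\poly_(j < n) al j)`_j = al j.
  by rewrite coef_poly; case: ltnP => // /big[].
have cB j : (\poly_(j < n) be j)`_j = be j.
  by rewrite coef_poly; case: ltnP => // /big[].
have p1 : (1 < p)%N by apply: prime_gt1.
have Sndvd j : (p %| j)%N -> ~~ (p %| j.+1)%N.
  by move=> dj; rewrite -addn1 dvdn_addr // dvdn1; move: p1; case: (p) => [|[]].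
move=> j; case: (boolP (p %| j)%N) => [dj|/offp //]; split.
  have := congr1 (fun q : {poly K} => q`_j) E.
  rewrite coefD coefMX cA coef0; case: j dj => [|j] dj /=; first by rewrite addr0.
  have ndj : ~~ (p %| j)%N by apply: contraL dj; apply: Sndvd.
  by rewrite cB (offp _ ndj).2 addr0.
have := congr1 (fun q : {poly K} => q`_j.+1) E.
by rewrite coefD coefMX cA coef0 /= cB (offp _ (Sndvd _ dj)).1 add0r.
Qed.

Lemma deriv0_poly (f : {poly K}) : f^`() = 0 ->
  f = \sum_(k < ((size f).-1 %/ p).+1) f`_(p * k) *: 'X^(p * k).
Proof.
move=> f'0; apply/polyP => j; rewrite coef_sum.
under eq_bigr => k _ do rewrite coefZ coefXn.
have p0 : (0 < p)%N by apply: prime_gt0.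
case: (boolP (p %| j)%N) => [/dvdnP[k ->]|nd]; last first.
  rewrite (deriv0_coef f'0 nd) big1 // => k _.
  by case: eqP => [e|_]; [move: nd; rewrite e dvdn_mulr|rewrite mulr0].
rewrite mulnC; case: (ltnP k ((size f).-1 %/ p).+1) => [lt|le].
  rewrite (bigD1 (Ordinal lt)) //= eqxx mulr1 big1 ?addr0 // => i ne.
  rewrite eqn_pmul2l //; case: eqP => [e|_]; last by rewrite mulr0.
  by case/eqP: ne; apply: val_inj.
rewrite nth_default; last first.
  by move: le; rewrite ltn_divLR // mulnC; case: (size f).
rewrite big1 // => i _; rewrite eqn_pmul2l //; case: eqP => [e|_]; last by rewrite mulr0.
by move: (ltn_ord i) le; rewrite -e ltnNge => /negbTE ->.
Qed.

(** Since f is a polynomial in $X^p$, writing each coefficient as $\sum_i h_i^p m_i$ and pulling the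
    Frobenius out gives $f(x) = \sum_i g_i(x)^p m_i$. The degrees of the $g_i$ are at most deg f /
    p, which later contradicts minimality. *)
Lemma pspan_horner (F : K -> Prop) (f : {poly K}) x : is_subfield F ->
  f^`() = 0 -> (forall j, pspan F f`_j) -> exists g : I -> {poly K},
  [/\ forall i, poly_over F (g i),
      forall i, (size (g i) <= ((size f).-1 %/ p).+1)%N,
      f.[x] = \sum_i (g i).[x] ^+ p * m i &
      (forall i, g i = 0) -> f = 0].
Proof.
move=> hF f'0 hf; set n := ((size f).-1 %/ p).+1.
have /boolp.choice[h hP] : forall j, exists h : I -> K,
    (forall i, F (h i)) /\ f`_j = \sum_i h i ^+ p * m i.
  by move=> j; have [h] := hf j; exists h.
have fE := deriv0_poly f'0; rewrite -/n in fE.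
exists (fun i => \poly_(k < n) h (p * k)%N i); split.
- by move=> i j; rewrite coef_poly; case: ifP => _; [apply: (hP _).1|apply: sf0].
- by move=> i; apply: size_poly.
- under [RHS]eq_bigr => i _.
    rewrite horner_poly pth_sum mulr_suml.
    over.
  rewrite exchange_big /= {1}fE horner_sum; apply: eq_bigr => k _.
  rewrite hornerZ hornerXn (hP _).2 mulr_suml; apply: eq_bigr => i _.
  by rewrite exprMn -exprM mulrAC [(k * p)%N]mulnC.
move=> g0; rewrite fE big1 // => k _; rewrite (hP _).2 big1 ?scale0r // => i _.
have := congr1 (fun q : {poly K} => q`_k) (g0 i).
rewrite coef_poly ltn_ord coef0 => ->.
by rewrite expr0n gtn_eqF ?prime_gt0 // mul0r.
Qed.

Section Chains.

Variables (F : K -> Prop) (x : nat -> K).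
Hypothesis hF : is_subfield F.
Hypothesis dF : forall c, F c -> F (d c).
Hypothesis dx : forall i, d (x i) = x i.+1.
Hypothesis constF : forall c, F c -> d c = 0 -> pspan F c.

Let hC n : is_subfield (chain F x n).
Proof. by apply: chain_subfield => // i _; apply: unital_field. Qed.

Lemma affine_coefs n (f : {poly K}) : poly_over (chain F x n) f ->
  exists al be : nat -> K, [/\ forall j, chain F x n (al j),
    forall j, chain F x n (be j), forall j, d f`_j = al j + be j * x n &
    forall j, d f`_j = 0 -> al j = 0 /\ be j = 0].
Proof.
move=> Ff.
have /boolp.choice[ab abP] : forall j, exists ab : K * K,
   [/\ chain F x n ab.1, chain F x n ab.2, d f`_j = ab.1 + ab.2 * x n &
      d f`_j = 0 -> ab.1 = 0 /\ ab.2 = 0].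
  move=> j; have [al [be h]] := chain_der_affine dD dM hF dF dx
    (fun i (_ : (i < n)%N) => @unital_field _ _ _) (Ff j).
  by exists (al, be).
exists (fun j => (ab j).1), (fun j => (ab j).2).
by split=> j; case: (abP j).
Qed.

(** The coefficients of [map_poly d f] involve $x_n$ linearly, so its value at $x_n$ is also the
    value of a polynomial g whose coefficients do not leave the chain. *)
Lemma affine_horner n (f : {poly K}) (al be : nat -> K) :
  (forall j, chain F x n (al j)) -> (forall j, chain F x n (be j)) ->
  (forall j, d f`_j = al j + be j * x n) ->
  let g := \poly_(j < size f) al j + \poly_(j < size f) be j * 'X in
  poly_over (chain F x n) g /\ g.[x n] = (map_poly d f).[x n].
Proof.
move=> Fal Fbe E /=; have Cp (al' : nat -> K) : (forall j, chain F x n (al' j)) ->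
    poly_over (chain F x n) (\poly_(j < size f) al' j).
  by move=> h j; rewrite coef_poly; case: ifP => // _; apply: sf0.
split; first by apply: poverD => //; [|apply: poverM => //; [|apply: poverX => //]]; apply: Cp.
rewrite hornerD hornerM hornerX !horner_poly mulr_suml -big_split /=.
by apply: eq_bigr => j _; rewrite E; ring.
Qed.

(** Induction on n. A constant P/Q equals $f/Q^p$ with $f = P Q^{p-1}$, and p-th powers are
    constants, so the value of f is a constant. If f' were nonzero, solving d f(x_n) = 0 would put
    $x_{n+1}$ into the chain. So f' = 0, the coefficients of f are constants by [spread], and the
    induction hypothesis feeds [pspan_horner]. *)
Lemma chain_pspan n : (forall i, (i < n)%N -> transc (chain F x i) (x i)) ->
  ~ chain F x n (x n) ->
  forall c, chain F x n c -> d c = 0 -> pspan (chain F x n) c.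
Proof.
elim: n => [|n IHn] tr nin c; first exact: constF.
move=> [P [Q [FP FQ uQ E]]] dc0.
have tn : transc (chain F x n) (x n) by apply: tr.
have {}IHn := IHn (fun i h => tr i (ltnW h)) (transc_notin (hC n) tn).
pose f := P * Q ^+ p.-1.
have p0 : (0 < p)%N by apply: prime_gt0.
have Ff : poly_over (chain F x n) f by apply: poverM => //; apply: poverX_n.
have fx : f.[x n] = c * Q.[x n] ^+ p.
  by rewrite hornerM horner_exp -E -mulrA -exprS prednK.
have dfx : d f.[x n] = 0 by rewrite fx dM dc0 der_pth mul0r mulr0 addr0.
have Cx : chain F x n.+1 (x n) by apply: adj_gen.
have sub e : chain F x n e -> chain F x n.+1 e by apply: adj_base.
have Cdf : chain F x n.+1 (map_poly d f).[x n].
  apply: pover_horner => // j; rewrite coef_map_id0 ?(der0 dD) //.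
  by apply: (chain_der dD dM hF dF dx) => // i _; apply: unital_field.
have Cf' : chain F x n.+1 f^`().[x n].
  by apply: pover_horner => //; apply: pover_deriv => //; apply: poly_over_sub Ff.
have f'0 : f^`() = 0.
  apply: tn; first exact: pover_deriv.
  apply: contrapT => /eqP nz; apply: nin.
  have := der_horner dD dM f (x n); rewrite dfx dx => /esym/eqP.
  rewrite addrC addr_eq0 => /eqP E1.
  have -> : x n.+1 = f^`().[x n]^-1 * - (map_poly d f).[x n] by rewrite -E1 mulKf.
  by apply: sfM => //; [apply: sfV|apply: sfN].
have mdf0 : (map_poly d f).[x n] = 0.
  by have := der_horner dD dM f (x n); rewrite dfx f'0 horner0 mul0r addr0.
have [al [be [Fal Fbe Eab z]]] := affine_coefs Ff.
have [Fg gx] := affine_horner Fal Fbe Eab.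
have g0 := tn _ Fg (etrans gx mdf0).
have ab0 := spread f'0 (fun j (h : f`_j = 0) => z j (etrans (congr1 d h) (der0 dD))) g0.
have [|g [Fgi _ Eg _]] := @pspan_horner (chain F x n) f (x n) (hC n) f'0.
  by move=> j; apply: IHn => //; rewrite Eab (ab0 j).1 (ab0 j).2 mul0r addr0.
exists (fun i => (g i).[x n] * Q.[x n]^-1).
  move=> i; apply: sfM => //; first by apply: adj_horner.
  by apply: sfV => //; apply: adj_horner.
have uQp : Q.[x n] ^+ p \is a GRing.unit by rewrite unitrX.
rewrite -[c](mulrK uQp) -fx Eg mulr_suml; apply: eq_bigr => i _.
by rewrite exprMn exprVn mulrAC.
Qed.

(** Minimality of the size makes f the minimal polynomial of $x_n$ over $F(x_0, \dots, x_{n-1})$;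
    the last clause is separability. *)
Definition sep_alg n (f : {poly K}) :=
  [/\ f \is monic, poly_over (chain F x n) f, f.[x n] = 0,
      forall P, poly_over (chain F x n) P -> P != 0 -> P.[x n] = 0 ->
        (size f <= size P)%N & f^`().[x n] != 0].

Hypothesis indep : forall h : I -> K,
  \sum_i h i ^+ p * m i = 0 -> forall i, h i = 0.

(** Take the least n with $x_n$ algebraic and its minimal polynomial f. If f'(x_n) = 0, then f' = 0
    and the coefficients of f turn out to be constants, so $0 = f(x_n) = \sum_i g_i(x_n)^p m_i$.
    Independence gives $g_i(x_n) = 0$ with deg g_i < deg f, so all $g_i$ vanish and f = 0. *)
Lemma transc_or_sep : (forall n, transc (chain F x n) (x n)) \/
  exists n f, (forall i, (i < n)%N -> transc (chain F x i) (x i)) /\ sep_alg n f.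
Proof.
case: (pselect (forall n, transc (chain F x n) (x n))) => [|/existsNP/ex_minimal]; first by left.
move=> [n [ntr minn]]; right.
have tr i : (i < n)%N -> transc (chain F x i) (x i).
  by move=> lt; apply: contrapT => /minn; rewrite leqNgt lt.
pose bad k := exists P : {poly K},
  [/\ poly_over (chain F x n) P, P != 0, P.[x n] = 0 & size P = k].
have [|k [[P [FP P0 Px sP]] mink]] := @ex_minimal bad.
  move/existsNP: ntr => [P /not_implyP[FP /not_implyP[Px /eqP P0]]].
  by exists (size P), P.
have uP : lead_coef P != 0 by rewrite lead_coef_eq0.
pose f := (lead_coef P)^-1 *: P.
have sf : size f = k by rewrite size_scale ?invr_eq0.
have mf : f \is monic by rewrite monicE lead_coefZ mulVf.
have Ff : poly_over (chain F x n) f.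
  by apply: poverZ => //; apply: sfV => //; apply: FP.
have fx : f.[x n] = 0 by rewrite hornerZ Px mulr0.
have minf P' : poly_over (chain F x n) P' -> P' != 0 -> P'.[x n] = 0 ->
    (size f <= size P')%N.
  by move=> h1 h2 h3; rewrite sf; apply: mink; exists P'.
exists n, f; split; first exact: tr.
rewrite /sep_alg; split=> //; apply/negP => /eqP f'x.
have f0 : f != 0 by apply: monic_neq0.
have f'0 : f^`() = 0.
  apply/eqP; apply/negPn/negP => nz.
  have := minf _ (pover_deriv (hC n) Ff) nz f'x.
  by rewrite leqNgt (lt_size_deriv f0).
have p1 : (1 < p)%N by apply: prime_gt1.
have sz1 : (1 < size f)%N.
  rewrite ltnNge; apply/negP => /size1_polyC E.
  by move: fx f0; rewrite E hornerC => ->; rewrite polyC0 eqxx.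
have dvdp : (p %| (size f).-1)%N.
  apply: contraT => nd; exfalso; have := deriv0_coef f'0 nd.
  by move/eqP; rewrite -/(lead_coef f) lead_coef_eq0 (negbTE f0).
have lep : (p <= (size f).-1)%N by apply: dvdn_leq => //; case: (size f) sz1 => [|[]].
have nin : ~ chain F x n (x n).
  move=> Cx; have := minf ('X - (x n)%:P) (poverB (hC n) (poverX (hC n)) (poverC (hC n) Cx)).
  rewrite polyXsubC_eq0 !hornerE subrr size_XsubC => /(_ isT erefl) le2.
  by move: lep le2 p1; clear; lia.
have mdf0 : (map_poly d f).[x n] = 0.
  by have := der_horner dD dM f (x n); rewrite fx f'x (der0 dD) mul0r addr0.
have [al [be [Fal Fbe Eab z]]] := affine_coefs Ff.
have [Fg gx] := affine_horner Fal Fbe Eab.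
have z' j (h : f`_j = 0) := z j (etrans (congr1 d h) (der0 dD)).
have top j : ((size f).-1 <= j)%N -> al j = 0 /\ be j = 0.
  rewrite leq_eqVlt => /orP[/eqP <-|lt].
    by apply: z; move/eqP: mf; rewrite /lead_coef => ->; rewrite (der1 dM).
  by apply: z'; rewrite nth_default //; move: lt; case: (size f).
(* The degree drops below that of f: the leading coefficient 1 is killed by d, and the term of
   degree deg f coming from the second sum belongs to an index not divisible by p, where f has no
   coefficient. *)
have g0 : \poly_(j < size f) al j + \poly_(j < size f) be j * 'X = 0.
  apply/eqP; apply/negPn/negP => nz; have := minf _ Fg nz (etrans gx mdf0).
  rewrite leqNgt => /negP; apply; rewrite -(prednK (ltnW sz1)) ltnS.
  apply/leq_sizeP => j lej; rewrite coefD coefMX !coef_poly.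
  have [-> _] := top j lej; rewrite if_same add0r.
  case: j lej => [//|j] /=.
  rewrite leq_eqVlt => /orP[/eqP ej|]; last by rewrite ltnS => /top[_ ->]; rewrite if_same.
  have nd : ~~ (p %| j)%N.
    apply: contraL dvdp => dj; rewrite ej -addn1 dvdn_addr // dvdn1.
    by move: p1; case: (p) => [|[]].
  by have [_ ->] := z' j (deriv0_coef f'0 nd); rewrite if_same.
have ab0 := spread f'0 z' g0.
have [|g [Fgi szg Eg gz]] := @pspan_horner (chain F x n) f (x n) (hC n) f'0.
  by move=> j; apply: chain_pspan => //; rewrite Eab (ab0 j).1 (ab0 j).2 mul0r addr0.
move: f0; rewrite gz ?eqxx // => i; apply/eqP; apply/negPn/negP => nz.
move: Eg; rewrite fx => /esym/indep/(_ i) gx0.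
have := minf _ (Fgi i) nz gx0; rewrite leqNgt => /negP; apply.
apply: leq_ltn_trans (szg i) _; rewrite -[X in (_ < X)%N](ltn_predK sz1) ltnS.
by apply: ltn_Pdiv => //; apply: leq_trans lep; apply: ltnW.
Qed.

End Chains.

End PthPowers.

(** * Multivariate polynomials *)

Section Widening.

Variables (n : nat) (R : nzRingType).

Lemma mwiden_coef0 (g : {mpoly R[n]}) (m : 'X_{1..n.+1}) :
  m ord_max != 0%N -> (mwiden g)@_m = 0.
Proof.
move=> nz; rewrite [g]mpolyE (raddf_sum (@mwiden n R)) raddf_sum /= big1 // => k _.
rewrite mwidenZ mwidenX mcoeffZ mcoeffX; case: eqP => [e|_]; last by rewrite mulr0.
by move: nz; rewrite -e mnmwiden_ordmax.
Qed.

Lemma mderiv_mwiden (g : {mpoly R[n]}) : (mwiden g)^`M(ord_max) = 0.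
Proof.
apply/mpolyP => m; rewrite mcoeff_deriv mcoeff0 mwiden_coef0 ?mul0rn //.
by rewrite mnmDE mnmE eqxx addn1.
Qed.

End Widening.

(** [muni] is a left inverse of [mmulti]; this is checked on widened polynomials and on the last
    variable. *)
Lemma mmulti_inj n (R : comNzRingType) (c : {poly {mpoly R[n]}}) :
  mmulti c = 0 -> c = 0.
Proof.
have muniX m : muni ('X_[m] : {mpoly R[n.+1]}) =
    'X_[[multinom (m (widen_ord (leqnSn n) i)) | i < n]] *: 'X^(m ord_max).
  by rewrite muniE msuppX big_seq1 mcoeffX eqxx scale1r.
have muniW (g : {mpoly R[n]}) : muni (mwiden g) = g%:P.
  rewrite {1}[g]mpolyE (raddf_sum (@mwiden n R)) (raddf_sum (@muni n R)) [in RHS](mpolyE g) raddf_sum /=.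
  apply: eq_bigr => m _; rewrite mwidenZ mwidenX muniZ muniX.
  rewrite mnmwiden_ordmax expr0 -mul_mpolyC polyCM -mul_polyC; congr (_ * _).
  rewrite -mul_polyC mulr1; congr ('X_[_])%:P; apply/mnmP => i.
  by rewrite mnmE mnmwiden_widen.
have muniM : muni ('X_ord_max : {mpoly R[n.+1]}) = 'X.
  rewrite muniX mnmE eqxx expr1 -[RHS]scale1r; congr (_ *: _).
  rewrite -mpolyX0; congr ('X_[_]); apply/mnmP => i; rewrite !mnmE.
  by rewrite eq_sym -val_eqE /= ltn_eqF.
move=> /(congr1 (@muni n R)); rewrite raddf0 /mmulti raddf_sum /= => E.
rewrite -[RHS]E -[LHS]coefK poly_def; apply: eq_bigr => i _.
by rewrite rmorphM rmorphXn /= muniW muniM mul_polyC.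
Qed.

Definition mpoly_over (S : nzRingType) (G : S -> Prop) N (P : {mpoly S[N]}) :=
  forall m, G P@_m.

Section Evaluation.

Variables (S K : comNzRingType) (h : {rmorphism S -> K}) (x : nat -> K).

Notation ev := (mmap h (fun j => x (nat_of_ord j))).

Lemma ev_mwiden N (g : {mpoly S[N]}) : ev (mwiden g) = ev g.
Proof.
rewrite [g]mpolyE (raddf_sum (@mwiden N S)) !raddf_sum /=; apply: eq_bigr => m _.
rewrite mwidenZ mwidenX !mmapZ !mmapX; congr (_ * _).
rewrite /mmap1 big_ord_recr /= mnmwiden_ordmax expr0 mulr1.
by apply: eq_bigr => i _; rewrite mnmwiden_widen.
Qed.

Lemma ev_mmulti N (c : {poly {mpoly S[N]}}) :
  ev (mmulti c) = (map_poly ev c).[x N].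
Proof.
rewrite /mmulti raddf_sum /= (@horner_coef_wide _ (size c)); last exact: size_poly.
apply: eq_bigr => i _.
by rewrite rmorphM rmorphXn /= ev_mwiden mmapX mmap1U coef_map_id0 ?rmorph0.
Qed.

(** This links the separant in the closedness axiom with the derivative of a minimal polynomial. *)
Lemma ev_mderiv_mmulti N (c : {poly {mpoly S[N]}}) :
  ev (mmulti c)^`M(ord_max) = (map_poly ev c)^`().[x N].
Proof.
have mdX i : (('X_ord_max : {mpoly S[N.+1]}) ^+ i)^`M(ord_max) =
    ('X_ord_max) ^+ i.-1 *+ i.
  have mM (a b : {mpoly S[N.+1]}) :
    (a * b)^`M(ord_max) = a^`M(ord_max) * b + a * b^`M(ord_max) by apply: mderivM.
  have mX1 : ('X_ord_max : {mpoly S[N.+1]})^`M(ord_max) = 1.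
    rewrite mderivX mnmE eqxx scale1r -mpolyX0; congr 'X_[_].
    by apply/mnmP => k; rewrite mnmBE subnn mnmE.
  elim: i => [|[|i] IHi]; first by rewrite !expr0 mulr0n -mpolyC1 mderivC.
    by rewrite expr1 mX1 expr0.
  by rewrite exprS mM IHi mX1 mul1r /= mulrnAr -exprS [RHS]mulrS.
rewrite /mmulti (raddf_sum (mderiv ord_max)) /= raddf_sum /=.
rewrite (@horner_deriv _ _ (size c)); last exact: size_poly.
apply: eq_bigr => i _; rewrite mderivM mderiv_mwiden mul0r add0r mdX.
rewrite coef_map_id0 ?rmorph0 // rmorphM /= ev_mwiden rmorphMn rmorphXn /=.
by rewrite mmapX mmap1U.
Qed.


Lemma mmap_over (G : S -> Prop) (F : K -> Prop) N (P : {mpoly S[N]}) :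
  F 0 -> F 1 -> (forall a b, F a -> F b -> F (a + b)) ->
  (forall a b, F a -> F b -> F (a * b)) -> (forall s, G s -> F (h s)) ->
  (forall j, (j < N)%N -> F (x j)) -> (forall m, G P@_m) -> F (ev P).
Proof.
move=> F0 F1 FD FM GF Fx GP; rewrite /mmap; apply: (big_ind F) => // m _.
apply: (FM); first exact: GF.
rewrite /mmap1; apply: (big_ind F); [exact: F1|exact: FM|move=> j _].
elim: (m j) => [|k IHk]; first by rewrite expr0.
by rewrite exprS; apply: (FM) => //; apply: Fx.
Qed.

End Evaluation.

Lemma rmorph_mmap (S K K' : comNzRingType) (h : {rmorphism S -> K})
    (g : {rmorphism K -> K'}) N (z : 'I_N -> K) (P : {mpoly S[N]}) :
  g (mmap h z P) = mmap (g \o h) (g \o z) P.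
Proof.
rewrite /mmap rmorph_sum; apply: eq_bigr => m _; rewrite rmorphM rmorph_prod.
by congr (_ * _); apply: eq_bigr => j _; rewrite rmorphXn.
Qed.

Lemma mmap_map_mpoly (S S' K : comNzRingType) (s : {rmorphism S -> S'})
    (h : {rmorphism S' -> K}) N (z : 'I_N -> K) (P : {mpoly S[N]}) :
  mmap h z (map_mpoly s P) = mmap (h \o s) z P.
Proof.
have -> : map_mpoly s P = \sum_(m <- msupp P) s P@_m *: 'X_[m].
  by apply: eq_bigr => m _; rewrite mmap1_id /= mul_mpolyC.
rewrite (raddf_sum (mmap h z)); apply: eq_bigr => m _.
by rewrite /= mmapZ mmapX.
Qed.

(* S, G and h allow coefficients to be taken in a subring G of S, mapped to K. *)
Section Fractions.

Variables (S : comNzRingType) (G : S -> Prop) (K : fieldType).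
Variables (h : {rmorphism S -> K}) (x : nat -> K).
Hypothesis G1 : G 1.
Hypothesis GB : forall a b, G a -> G b -> G (a - b).
Hypothesis GM : forall a b, G a -> G b -> G (a * b).

Notation ev := (mmap h (fun j => x (nat_of_ord j))).

Let G0 : G 0. Proof. by rewrite -(subrr 1); apply: GB. Qed.
Let GD a b : G a -> G b -> G (a + b).
Proof. by move=> ga gb; rewrite -[b]opprK; apply: GB => //; rewrite -sub0r; apply: GB. Qed.

Lemma mpolyoverC N c : G c -> @mpoly_over S G N c%:MP.
Proof. by move=> Gc m; rewrite mcoeffC; case: eqP; rewrite ?mulr1 ?mulr0. Qed.

Lemma mpolyoverX N i : @mpoly_over S G N 'X_i.
Proof. by move=> m; rewrite mcoeffX; case: eqP. Qed.

Lemma mpolyoverB N (P Q : {mpoly S[N]}) :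
  mpoly_over G P -> mpoly_over G Q -> mpoly_over G (P - Q).
Proof. by move=> hP hQ m; rewrite mcoeffB; apply: GB. Qed.

Lemma mpolyoverD N (P Q : {mpoly S[N]}) :
  mpoly_over G P -> mpoly_over G Q -> mpoly_over G (P + Q).
Proof. by move=> hP hQ m; rewrite mcoeffD; apply: GD. Qed.

Lemma mpolyoverM N (P Q : {mpoly S[N]}) :
  mpoly_over G P -> mpoly_over G Q -> mpoly_over G (P * Q).
Proof.
by move=> hP hQ m; rewrite mcoeffM; apply: big_ind => // k _; apply: GM.
Qed.

Lemma mpolyover_mwiden N (g : {mpoly S[N]}) : mpoly_over G g -> mpoly_over G (mwiden g).
Proof.
move=> hg m; rewrite [g]mpolyE (raddf_sum (@mwiden N S)) raddf_sum /=.
apply: big_ind => // k _; rewrite mwidenZ mwidenX mcoeffZ mcoeffX.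
by case: eqP => _; rewrite ?mulr1 ?mulr0.
Qed.

Lemma mpolyover_mmulti N (c : {poly {mpoly S[N]}}) :
  (forall i, mpoly_over G c`_i) -> mpoly_over G (mmulti c).
Proof.
move=> hc; rewrite /mmulti; apply: (big_ind (mpoly_over G (N := N.+1))).
- by move=> m; rewrite mcoeff0.
- exact: mpolyoverD.
move=> i _; apply: mpolyoverM; first exact: mpolyover_mwiden.
elim: (nat_of_ord i) => [|k IHk]; first by rewrite expr0; apply: mpolyoverC.
by rewrite exprS; apply: mpolyoverM => //; apply: mpolyoverX.
Qed.

Definition mfrac N e := exists P Q : {mpoly S[N]},
  [/\ mpoly_over G P, mpoly_over G Q, ev Q != 0 & e * ev Q = ev P].

Lemma mfrac_subfield N : is_subfield (mfrac N).
Proof.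
have o1 : ev (1 : {mpoly S[N]}) != 0 by rewrite rmorph1 oner_neq0.
have c1 : mpoly_over G (1 : {mpoly S[N]}) by apply: mpolyoverC.
split.
- by exists 1, 1; split=> //; rewrite mul1r.
- move=> a b [P [Q [hP hQ q0 E]]] [P' [Q' [hP' hQ' q0' E']]].
  exists (P * Q' - P' * Q), (Q * Q'); split.
  + by apply: mpolyoverB; apply: mpolyoverM.
  + exact: mpolyoverM.
  + by rewrite rmorphM mulf_neq0.
  + by rewrite rmorphB !rmorphM /= -E -E'; ring.
- move=> a b [P [Q [hP hQ q0 E]]] [P' [Q' [hP' hQ' q0' E']]].
  exists (P * P'), (Q * Q'); split; try exact: mpolyoverM.
  + by rewrite rmorphM mulf_neq0.
  + by rewrite !rmorphM /= -E -E'; ring.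
- move=> a [P [Q [hP hQ q0 E]]]; have [P0|P0] := eqVneq (ev P) 0.
    have -> : a = 0.
      by move/eqP: E; rewrite P0 mulf_eq0 (negbTE q0) orbF => /eqP.
    exists 0, 1; split=> //; last by rewrite rmorph0 invr0 mul0r.
    by move=> m; rewrite mcoeff0.
  exists Q, P; split=> //; have a0 : a != 0.
    by apply: contraNneq P0 => a0; rewrite -E a0 mul0r.
  by rewrite -E mulKf.
- by move=> a _ a0; rewrite unitfE.
Qed.

Lemma mfrac_chain N (F : K -> Prop) : (forall c, F c -> exists2 s, G s & c = h s) ->
  forall e, chain F x N e -> mfrac N e.
Proof.
move=> FG; apply: chain_min; first exact: mfrac_subfield.
  move=> c /FG[s Gs ->]; exists s%:MP, 1; split.
  - exact: mpolyoverC.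
  - exact: mpolyoverC.
  - by rewrite rmorph1 oner_neq0.
  - by rewrite rmorph1 mulr1 mmapC.
move=> i lt; exists 'X_(Ordinal lt), 1; split.
- exact: mpolyoverX.
- exact: mpolyoverC.
- by rewrite rmorph1 oner_neq0.
- by rewrite rmorph1 mulr1 mmapX mmap1U.
Qed.

(** The denominators of the coefficients are multiplied together, one coefficient at a time. *)
Lemma common_denominator N (T : {poly K}) : poly_over (mfrac N) T ->
  exists (D : {mpoly S[N]}) (c : {poly {mpoly S[N]}}),
  [/\ forall i, mpoly_over G c`_i, ev D != 0 & ev D *: T = map_poly ev c].
Proof.
move=> hT.
have [D [c [hc hD D0 E]]] : exists (D : {mpoly S[N]}) (c : nat -> {mpoly S[N]}),
  [/\ forall i, mpoly_over G (c i), mpoly_over G D, ev D != 0 &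
      forall i, (i < size T)%N -> T`_i * ev D = ev (c i)].
  elim: (size T) => [|k [D [c [hc hD D0 E]]]].
    exists 1, (fun=> 0); split=> //.
    - by move=> i m; rewrite mcoeff0.
    - exact: mpolyoverC.
    - by rewrite rmorph1 oner_neq0.
  have [P [Q [hP hQ Q0 Ek]]] := hT k.
  exists (D * Q), (fun i => if i == k then P * D else c i * Q); split.
  - by move=> i; case: ifP => _; apply: mpolyoverM.
  - exact: mpolyoverM.
  - by rewrite rmorphM mulf_neq0.
  - move=> i; rewrite ltnS leq_eqVlt; case: eqP => [-> _|_ /= lt].
      by rewrite !rmorphM /= -Ek; ring.
    by rewrite !rmorphM /= -E //; ring.
exists D, (\poly_(i < size T) c i); split=> //.
  by move=> i; rewrite coef_poly; case: ifP => // _ m; rewrite mcoeff0.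
apply/polyP => i; rewrite coefZ coef_map_id0 ?rmorph0 // coef_poly.
case: ltnP => [lt|le]; first by rewrite mulrC E.
by rewrite rmorph0 nth_default ?mulr0.
Qed.

End Fractions.

(** * Algebraic independence and partial derivatives *)

Definition alg_indep (K K' : fieldType) (i : {rmorphism K -> K'}) (x : nat -> K') N :=
  forall g : {mpoly K[N]}, mmap i (fun j => x (nat_of_ord j)) g = 0 -> g = 0.

Section AlgIndep.

Variables (K K' : fieldType) (i : {rmorphism K -> K'}) (x : nat -> K').

Notation ev := (mmap i (fun j => x (nat_of_ord j))).

Lemma alg_indepS N : alg_indep i x N.+1 -> alg_indep i x N.
Proof.
move=> ind g; rewrite -ev_mwiden => /ind e; apply: (@inj_mwiden N K).
by rewrite raddf0.
Qed.

Lemma alg_indep_le M N : (M <= N)%N -> alg_indep i x N -> alg_indep i x M.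
Proof.
by move/subnK<-; elim: (N - M)%N => // k IHk; rewrite addSn => /alg_indepS.
Qed.

(** Clearing denominators turns a polynomial equation for $x_N$ over the chain into one polynomial
    in N+1 variables vanishing at $x_0, \dots, x_N$. *)
Lemma alg_indep_transc (F : K' -> Prop) N : (forall c, F c -> exists b, c = i b) ->
  alg_indep i x N.+1 -> transc (chain F x N) (x N).
Proof.
move=> Fi ind T hT Tx.
have hTf : poly_over (mfrac (fun _ : K => True) i x N) T.
  move=> j; apply: (@mfrac_chain _ _ _ i x I (fun _ _ _ _ => I) (fun _ _ _ _ => I) N F).
    by move=> c /Fi[b ->]; exists b.
  exact: hT.
have [D [c [_ D0 E]]] := @common_denominator _ _ _ i x I (fun _ _ _ _ => I) (fun _ _ _ _ => I) N T hTf.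
have c0 : c = 0.
  by apply: mmulti_inj; apply: ind; rewrite ev_mmulti -E hornerZ Tx mulr0.
move: E; rewrite c0 map_poly0 => /eqP.
by rewrite scale_poly_eq0 (negbTE D0) => /eqP.
Qed.

(* [pder n e v] says that v is the derivative of e with respect to x_n; the
   quantification over all large N avoids comparing polynomial rings. *)
Definition pder n (e v : K') := exists N0, forall N (lt : (n < N)%N), (N0 <= N)%N ->
  exists P Q : {mpoly K[N]}, [/\ ev Q != 0, e * ev Q = ev P &
   v * ev Q ^+ 2 = ev P^`M(Ordinal lt) * ev Q - ev P * ev Q^`M(Ordinal lt)].

Hypothesis ind : forall N, alg_indep i x N.
Variable n : nat.

(** By independence the zero polynomial is the only numerator of 0. Together with [pderB] this is
    uniqueness of the partial derivative. *)
Lemma pder0 v : pder n 0 v -> v = 0.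
Proof.
move=> [N0 H]; have [P [Q [Q0 E1 E2]]] := H (maxn n.+1 N0) (leq_maxl _ _) (leq_maxr _ _).
have P0 : P = 0 by apply: ind; rewrite -E1 mul0r.
move: E2; rewrite P0 mderiv0 rmorph0 !mul0r subrr => /eqP.
by rewrite mulf_eq0 expf_eq0 /= (negbTE Q0) orbF => /eqP.
Qed.

Lemma pderC b : pder n (i b) 0.
Proof.
exists 0%N => N lt _; exists b%:MP, 1; rewrite rmorph1 oner_neq0 mulr1 mmapC.
by split=> //; rewrite -mpolyC1 !mderivC !rmorph0; ring.
Qed.

Lemma pderx j : pder n (x j) (j == n)%:R.
Proof.
exists j.+1 => N lt lej; exists 'X_(Ordinal lej), 1; rewrite rmorph1 oner_neq0 mulr1.
split=> //; first by rewrite mmapX mmap1U.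
rewrite mderivX -[in X in _ - X]mpolyC1 mderivC !rmorph0 mulr0 subr0 mulr1 expr1n mulr1.
rewrite mmapZ mnmE -val_eqE /=; case: eqP => [e|_]; last by rewrite !mulr0n (rmorph0 i) mul0r.
rewrite !mulr1n (rmorph1 i) mul1r mmapX /mmap1 big1 // => k _.
by rewrite mnmBE !mnmE -!val_eqE /= e subnn.
Qed.

Lemma pderB e e' v v' : pder n e v -> pder n e' v' -> pder n (e - e') (v - v').
Proof.
move=> [N0 H] [N0' H']; exists (maxn N0 N0') => N lt; rewrite geq_max => /andP[le le'].
have [P [Q [Q0 E1 E2]]] := H N lt le; have [P' [Q' [Q0' E1' E2']]] := H' N lt le'.
exists (P * Q' - P' * Q), (Q * Q'); split.
- by rewrite rmorphM mulf_neq0.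
- by rewrite rmorphB !rmorphM /= -E1 -E1'; ring.
rewrite mderivB !mderivM !(rmorphD, rmorphB, rmorphM) /=.
have -> : (v - v') * (ev Q * ev Q') ^+ 2 =
  (v * ev Q ^+ 2) * ev Q' ^+ 2 - (v' * ev Q' ^+ 2) * ev Q ^+ 2 by ring.
by rewrite E2 E2'; ring.
Qed.

Lemma pderM e e' v v' : pder n e v -> pder n e' v' ->
  pder n (e * e') (v * e' + e * v').
Proof.
move=> [N0 H] [N0' H']; exists (maxn N0 N0') => N lt; rewrite geq_max => /andP[le le'].
have [P [Q [Q0 E1 E2]]] := H N lt le; have [P' [Q' [Q0' E1' E2']]] := H' N lt le'.
exists (P * P'), (Q * Q'); split.
- by rewrite rmorphM mulf_neq0.
- by rewrite !rmorphM /= -E1 -E1'; ring.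
rewrite !mderivM !(rmorphD, rmorphM) /=.
have -> : (v * e' + e * v') * (ev Q * ev Q') ^+ 2 =
  (v * ev Q ^+ 2) * (e' * ev Q') * ev Q' + (v' * ev Q' ^+ 2) * (e * ev Q) * ev Q by ring.
by rewrite E2 E2' E1 E1'; ring.
Qed.

Lemma pderV e v : e != 0 -> pder n e v -> pder n e^-1 (- (v * e^-1 ^+ 2)).
Proof.
move=> e0 [N0 H]; exists N0 => N lt le.
have [P [Q [Q0 E1 E2]]] := H N lt le.
exists Q, P; split.
- by rewrite -E1 mulf_neq0.
- by rewrite -E1 mulKf.
have -> : - (v * e^-1 ^+ 2) * ev P ^+ 2 = - (v * ev Q ^+ 2).
  by rewrite -E1 exprMn exprVn; field.
by rewrite E2; ring.
Qed.

Lemma pderN e v : pder n e v -> pder n (- e) (- v).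
Proof.
rewrite -[- e]add0r -[- v]add0r; apply: pderB.
by have := pderC 0; rewrite rmorph0.
Qed.

Lemma pderD e e' v v' : pder n e v -> pder n e' v' -> pder n (e + e') (v + v').
Proof.
by move=> H /pderN H'; rewrite -[e']opprK -[v']opprK; apply: pderB.
Qed.

(** Being a field, this set contains a whole chain as soon as it contains the base field and the
    generators, so partial derivatives need to be computed on these only. *)
Lemma pder_stable (C : K' -> Prop) : is_subfield C ->
  is_subfield (fun e => C e /\ exists2 v, C v & pder n e v).
Proof.
move=> hC; split.
- split; first exact: sf1.
  by exists 0; [exact: sf0|have := pderC 1; rewrite rmorph1].
- move=> e e' [Ce [v Cv H]] [Ce' [v' Cv' H']]; split; first exact: sfB.
  by exists (v - v'); [apply: sfB|apply: pderB].
- move=> e e' [Ce [v Cv H]] [Ce' [v' Cv' H']]; split; first exact: sfM.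
  by exists (v * e' + e * v'); [apply: sfD => //; apply: sfM|apply: pderM].
- move=> e [Ce [v Cv H]]; split; first exact: sfV.
  have [->|e0] := eqVneq e 0.
    by exists 0; [exact: sf0|rewrite invr0; have := pderC 0; rewrite rmorph0].
  exists (- (v * e^-1 ^+ 2)); last exact: pderV.
  by apply: sfN => //; apply: sfM => //; apply: sfX => //; apply: sfV.
- by move=> e _ e0; rewrite unitfE.
Qed.

Lemma pder_horner (C : K' -> Prop) (f : {poly K'}) u v : is_subfield C ->
  poly_over (fun e => C e /\ exists2 v, C v & pder n e v) f -> pder n u v ->
  exists2 g, poly_over C g & pder n f.[u] (g.[u] + f^`().[u] * v).
Proof.
move=> hC; elim/poly_ind: f => [|f c IHf] hf hu.
  exists 0; first by move=> j; rewrite coef0; apply: sf0.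
  by rewrite deriv0 !horner0 mul0r addr0; have := pderC 0; rewrite rmorph0.
have hf' : poly_over (fun e => C e /\ exists2 v, C v & pder n e v) f.
  by move=> j; have := hf j.+1; rewrite coefD coefMX coefC /= addr0.
have [_ [w Cw Hc]] : C c /\ exists2 w, C w & pder n c w.
  by have := hf 0%N; rewrite coefD coefMX coefC /= add0r.
have [g hg H] := IHf hf' hu.
exists (g * 'X + w%:P).
  by apply: poverD => //; [apply: poverM => //; apply: poverX|apply: poverC].
have := pderD (pderM H hu) Hc.
rewrite derivD derivM derivX derivC !hornerE.
by congr pder; ring.
Qed.

End AlgIndep.

(** * Differential primitive elements *)

Section PrimitiveElement.

Variables (K K' : fieldType) (i : {rmorphism K -> K'}) (d : K -> K) (d' : K' -> K').
Hypothesis dD : forall x y, d' (x + y) = d' x + d' y.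
Hypothesis dM : forall x y, d' (x * y) = d' x * y + x * d' y.
Hypothesis i_d : forall a, d' (i a) = i (d a).
Variable t : K'.

Let T j := iter j d' t.

Hypothesis ind : forall N, alg_indep i T N.

(** By Leibniz, the highest derivative of t in $\delta^j(t^{(k)} z)$ is $t^{(j+k)}$, with
    coefficient z. The induction uses $\delta(t^{(k)} z) = t^{(k+1)} z + t^{(k)} \delta z$. *)
Lemma pder_twist n j k z :
  ((j + k < n)%N -> pder i T n (iter j d' (T k * i z)) 0) /\
  ((j + k = n)%N -> pder i T n (iter j d' (T k * i z)) (i z)).
Proof.
elim: j k z => [|j IHj] k z /=.
  have H := pderM (pderx i T n k) (pderC i T n z).
  split=> [lt|e]; move: H.
    by rewrite ltn_eqF // mul0r mulr0 addr0.
  by rewrite -e eqxx mul1r mulr0 addr0.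
have -> : d' (iter j d' (T k * i z)) =
    iter j d' (T k.+1 * i z) + iter j d' (T k * i (d z)).
  rewrite -iterS iterSr dM i_d; elim: (j) => //= l ->.
  by rewrite dD.
have [H1 H2] := IHj k.+1 z; have [H3 H4] := IHj k (d z).
split=> [lt|e].
  rewrite -[X in pder _ _ _ _ X]addr0; apply: pderD; last by apply: H3; apply: ltnW.
  by apply: H1; rewrite addnS.
rewrite -[X in pder _ _ _ _ X]addr0; apply: pderD; last by apply: H3; rewrite -e addSn.
by apply: H2; rewrite addnS.
Qed.

Variable F : K' -> Prop.
Hypothesis hF : is_subfield F.
Hypothesis Fi : forall c, F c -> exists b, c = i b.

Variables x y : K.
Let u := i x + t * i y.
Let U j := iter j d' u.
Let E := chain_union F T.

Lemma primitive_element n f : sep_alg E U n f -> chain E U n.+1 (i y).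
Proof.
move=> [_ Ef fU _ f'U].
have hE : is_subfield E by apply: chain_union_subfield => // j; apply: unital_field.
have hC m : is_subfield (chain E U m).
  by apply: chain_subfield => // j _; apply: unital_field.
have UE j : U j = iter j d' (i x) + iter j d' (T 0 * i y).
  by rewrite /U /u; elim: j => //= j ->; rewrite dD.
have ix j : iter j d' (i x) = i (iter j d x) by elim: j => //= j ->.
have pU j : (j < n)%N -> pder i T n (U j) 0.
  move=> lt; rewrite UE ix -[X in pder _ _ _ _ X]addr0; apply: pderD; first exact: pderC.
  by apply: (pder_twist n j 0 y).1; rewrite addn0.
have pUn : pder i T n (U n) (i y).
  rewrite UE ix -[X in pder _ _ _ _ X]add0r; apply: pderD; first exact: pderC.
  by apply: (pder_twist n n 0 y).2; rewrite addn0.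
pose C := chain E U n.
have EC e : E e -> C e.
  by apply: (@chain_mono _ E U 0 n) => // j _; apply: unital_field.
have hS := pder_stable i T n (hC n).
have FE e : F e -> E e by exists 0%N.
have TE j : E (T j) by exists j.+1; apply: chain_gen => // k _; apply: unital_field.
(* On generators the derivative with respect to $t^{(n)}$ is 0 or 1 for the derivatives of t, and 0
   for elements of F and for $u^{(k)}$ with k < n. *)
have fS : poly_over (fun e => C e /\ exists2 v, C v & pder i T n e v) f.
  move=> j; apply: (chain_min hS _ _ (Ef j)).
    move=> e [N]; apply: (chain_min hS) => [c Fc|k _].
      split; first by apply: EC; apply: FE.
      by have [b ->] := Fi Fc; exists 0; [exact: sf0|apply: pderC].
    split; first by apply: EC; apply: TE.
    exists (k == n)%:R; last exact: pderx.
    by case: eqP => _; [exact: sf1|exact: sf0].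
  move=> k lt; split; first by apply: chain_gen => // l _; apply: unital_field.
  by exists 0; [exact: sf0|apply: pU].
have [g hg] := pder_horner (hC n) fS pUn.
(* Differentiating f(u^(n)) = 0 gives g(u^(n)) + f'(u^(n)) y = 0, to be solved for y. *)
rewrite fU => /(pder0 ind)/eqP; rewrite addrC addr_eq0 => /eqP e.
have -> : i y = f^`().[U n]^-1 * - g.[U n] by rewrite -e mulKf.
apply: sfM => //; first by apply: sfV => //; apply: adj_horner => //; apply: pover_deriv.
by apply: sfN => //; apply: adj_horner.
Qed.

End PrimitiveElement.

(** * Ultraproducts of fields *)

Record ultrafilter (I : Type) (U : (I -> Prop) -> Prop) : Prop := Ultrafilter {
  ufS : forall A B : I -> Prop, (forall i, A i -> B i) -> U A -> U B;
  ufI : forall A B, U A -> U B -> U (fun i => A i /\ B i);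
  uf0 : ~ U (fun=> False);
  ufC : forall A, U A \/ U (fun i => ~ A i) }.

(** The index set for compactness arguments: the sets containing all lists above a given finite list
    form a proper filter, which extends to an ultrafilter. *)
Lemma ultrafilter_seq (J : Type) : exists U : (seq J -> Prop) -> Prop,
  ultrafilter U /\ forall j, U (List.In j).
Proof.
pose F (A : seq J -> Prop) := exists s, forall s', List.incl s s' -> A s'.
have FF : filter.ProperFilter F.
  split; first by case=> s /(_ s); apply; apply: List.incl_refl.
  split.
  - by exists [::].
  - move=> A B [s hA] [s' hB]; exists (List.app s s') => t inc; split.
      by apply: hA; apply: List.incl_tran inc; apply: List.incl_appl; apply: List.incl_refl.
    by apply: hB; apply: List.incl_tran inc; apply: List.incl_appr; apply: List.incl_refl.
  - by move=> A B AB [s hA]; exists s => t /hA/AB.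
have [U [uU FU]] := filter.ultraFilterLemma FF.
exists U; split; last first.
  by move=> j; apply: FU; exists [:: j] => s; apply; left.
have [pU _] := uU; have [U0 [UT UI US]] := pU.
split.
- by move=> A B AB; apply: US.
- by move=> A B; apply: UI.
- exact: U0.
- by move=> A; apply: filter.in_ultra_setVsetC uU.
Qed.

Section UltrafilterTheory.

Variables (I : Type) (U : (I -> Prop) -> Prop).
Hypothesis hU : ultrafilter U.

Lemma ufT (A : I -> Prop) : (forall i, A i) -> U A.
Proof.
move=> hA; case: (ufC hU A) => // /(ufS hU (B := fun=> False)) H.
by case: (uf0 hU); apply: H.
Qed.

Lemma uf_and A B : U (fun i => A i /\ B i) <-> U A /\ U B.
Proof.
split=> [H|[]]; last exact: ufI.
by split; apply: ufS H => // i [].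
Qed.

Lemma uf_not A : U (fun i => ~ A i) <-> ~ U A.
Proof.
split=> [H1 H2|H]; last by case: (ufC hU A).
by apply: (uf0 hU); apply: ufS (ufI hU H1 H2) => // i [].
Qed.

Lemma uf_or A B : U (fun i => A i \/ B i) <-> U A \/ U B.
Proof.
split=> [H|[]]; last 2 first.
- by apply: (ufS hU); left.
- by apply: (ufS hU); right.
case: (ufC hU A) => [|nA]; first by left.
by right; apply: ufS (ufI hU H nA) => // i [[]].
Qed.

Lemma uf_imp A B : U (fun i => A i -> B i) <-> (U A -> U B).
Proof.
split=> [H HA|H]; first by apply: ufS (ufI hU H HA) => // i [h /h].
case: (ufC hU A) => [/H|nA]; first by apply: ufS.
by apply: ufS nA.
Qed.

Lemma uf_iff A B : U (fun i => A i <-> B i) -> (U A <-> U B).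
Proof. by move=> H; split=> H'; apply: ufS (ufI hU H H') => // i [[]]; auto. Qed.

End UltrafilterTheory.

Section Ultraproduct.

Variables (I : Type) (U : (I -> Prop) -> Prop) (K : I -> fieldType).
Hypothesis hU : ultrafilter U.

Local Notation prodK := (forall i, K i).

(** Coordinates without a witness receive the default 0. *)
Lemma uf_choice (P : forall i, K i -> Prop) :
  U (fun i => exists x, P i x) -> exists x : prodK, U (fun i => P i (x i)).
Proof.
move=> H; exists (fun i => if pselect (exists x, P i x) is left h then projT1 (cid h) else 0).
apply: ufS H => // i h; case: (pselect _) => // h'.
exact: projT2 (cid h').
Qed.

Definition up_eq (x y : prodK) : Prop := U (fun i => x i = y i).

Lemma up_refl x : up_eq x x.
Proof. by apply: (ufT hU). Qed.

Lemma up_sym x y : up_eq x y -> up_eq y x.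
Proof. by apply: (ufS hU) => i ->. Qed.

Lemma up_trans y x z : up_eq x y -> up_eq y z -> up_eq x z.
Proof. by move=> H1 H2; apply: ufS (ufI hU H1 H2) => // i [-> ->]. Qed.

(** The quotient is realised by canonical representatives: [choose] returns the same element for all
    members of a class, so classes can be compared by plain equality. *)
Definition up_canon (x : prodK) : prodK := choose (fun y => `[< up_eq x y >]) x.

Lemma up_canon_eq x : up_eq x (up_canon x).
Proof.
apply/asboolP; apply: (chooseP (P := fun y => `[< up_eq x y >])).
by apply/asboolP; apply: up_refl.
Qed.

Lemma up_canonP x y : up_eq x y <-> up_canon x = up_canon y.
Proof.
split=> [xy|e]; last first.
  by apply: up_trans (up_canon_eq x) _; rewrite e; apply: up_sym (up_canon_eq y).
rewrite /up_canon.
have -> : choose (fun z => `[< up_eq x z >]) x = choose (fun z => `[< up_eq y z >]) x.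
  apply: eq_choose => z; apply/asboolP/asboolP; apply: up_trans => //.
  exact: up_sym.
by apply: choose_id; apply/asboolP; [apply: up_sym|apply: up_refl].
Qed.

(** The ultrafilter proof is an argument of the type so that the field structure can be attached to
    the type itself. *)
Definition uprod of ultrafilter U : Type := {x : prodK | up_canon x == x}.

Local Notation UP := (uprod hU).

HB.instance Definition _ := gen_eqMixin UP.
HB.instance Definition _ := gen_choiceMixin UP.

Definition rep (z : UP) : prodK := val z.

Lemma up_canon_idem x : up_canon (up_canon x) == up_canon x.
Proof. by apply/eqP/up_canonP/up_sym/up_canon_eq. Qed.

Definition cls (x : prodK) : UP := exist _ (up_canon x) (up_canon_idem x).

Lemma clsP x y : cls x = cls y <-> U (fun i => x i = y i).
Proof.
split=> [e|xy]; last by apply: val_inj; apply/up_canonP.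
by apply/up_canonP; apply: (congr1 rep e).
Qed.

Lemma repK z : cls (rep z) = z.
Proof. by apply: val_inj; apply/eqP; case: z. Qed.

Lemma rep_cls x : U (fun i => rep (cls x) i = x i).
Proof. by apply/clsP; rewrite repK. Qed.

Lemma cls_surj z : exists x, z = cls x.
Proof. by exists (rep z); rewrite repK. Qed.

Lemma cls_ext x y : (forall i, x i = y i) -> cls x = cls y.
Proof. by move=> e; apply/clsP; apply: (ufT hU). Qed.

Let addU (z w : UP) := cls (fun i => rep z i + rep w i).
Let oppU (z : UP) := cls (fun i => - rep z i).
Let mulU (z w : UP) := cls (fun i => rep z i * rep w i).
Let invU (z : UP) := cls (fun i => (rep z i)^-1).
Let zeroU := cls (fun=> 0).
Let oneU := cls (fun=> 1).

Let addE x y : addU (cls x) (cls y) = cls (fun i => x i + y i).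
Proof. by apply/clsP; apply: ufS (ufI hU (rep_cls x) (rep_cls y)) => // i [-> ->]. Qed.
Let mulE x y : mulU (cls x) (cls y) = cls (fun i => x i * y i).
Proof. by apply/clsP; apply: ufS (ufI hU (rep_cls x) (rep_cls y)) => // i [-> ->]. Qed.
Let oppE x : oppU (cls x) = cls (fun i => - x i).
Proof. by apply/clsP; apply: ufS (rep_cls x) => // i ->. Qed.
Let invE x : invU (cls x) = cls (fun i => (x i)^-1).
Proof. by apply/clsP; apply: ufS (rep_cls x) => // i ->. Qed.

Let addA : associative addU.
Proof.
move=> a b c; have [x ->] := cls_surj a; have [y ->] := cls_surj b.
by have [z ->] := cls_surj c; rewrite !addE; apply: cls_ext => i; rewrite addrA.
Qed.
Let addC : commutative addU.
Proof.
move=> a b; have [x ->] := cls_surj a; have [y ->] := cls_surj b.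
by rewrite !addE; apply: cls_ext => i; rewrite addrC.
Qed.
Let add0 : left_id zeroU addU.
Proof. by move=> a; have [x ->] := cls_surj a; rewrite addE; apply: cls_ext => i; rewrite add0r. Qed.
Let addN : left_inverse zeroU oppU addU.
Proof.
by move=> a; have [x ->] := cls_surj a; rewrite oppE addE; apply: cls_ext => i; rewrite addNr.
Qed.

HB.instance Definition _ := GRing.isZmodule.Build UP addA addC add0 addN.

Let mulA : associative mulU.
Proof.
move=> a b c; have [x ->] := cls_surj a; have [y ->] := cls_surj b.
by have [z ->] := cls_surj c; rewrite !mulE; apply: cls_ext => i; rewrite mulrA.
Qed.
Let mulC : commutative mulU.
Proof.
move=> a b; have [x ->] := cls_surj a; have [y ->] := cls_surj b.
by rewrite !mulE; apply: cls_ext => i; rewrite mulrC.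
Qed.
Let mul1 : left_id oneU mulU.
Proof. by move=> a; have [x ->] := cls_surj a; rewrite mulE; apply: cls_ext => i; rewrite mul1r. Qed.
Let mulD : left_distributive mulU addU.
Proof.
move=> a b c; have [x ->] := cls_surj a; have [y ->] := cls_surj b.
have [z ->] := cls_surj c; rewrite addE !mulE addE.
by apply: cls_ext => i; rewrite mulrDl.
Qed.
Let one0 : oneU != zeroU.
Proof.
apply/eqP => /clsP H; apply: (uf0 hU); apply: ufS H => // i /eqP.
by rewrite oner_eq0.
Qed.

HB.instance Definition _ := GRing.Zmodule_isComNzRing.Build UP mulA mulC mul1 mulD one0.

Let mulV z : z != 0 -> mulU (invU z) z = oneU.
Proof.
have [x ->] := cls_surj z => /eqP nz; rewrite invE mulE; apply/clsP.
have : U (fun i => x i <> 0) by apply/(uf_not hU) => H; apply: nz; apply/clsP.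
by apply: (ufS hU) => i /eqP h; rewrite mulVf.
Qed.
Let inv0 : invU 0 = 0.
Proof. by rewrite invE; apply: cls_ext => i; rewrite invr0. Qed.

HB.instance Definition _ := GRing.ComNzRing_isField.Build UP mulV inv0.

Lemma cls0 : cls (fun=> 0) = 0. Proof. by []. Qed.
Lemma cls1 : cls (fun=> 1) = 1. Proof. by []. Qed.
Lemma clsD x y : cls x + cls y = cls (fun i => x i + y i). Proof. exact: addE. Qed.
Lemma clsM x y : cls x * cls y = cls (fun i => x i * y i). Proof. exact: mulE. Qed.
Lemma clsN x : - cls x = cls (fun i => - x i). Proof. exact: oppE. Qed.
Lemma clsV x : (cls x)^-1 = cls (fun i => (x i)^-1). Proof. exact: invE. Qed.

Lemma clsX x n : cls x ^+ n = cls (fun i => x i ^+ n).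
Proof.
elim: n => [|n IHn]; first by rewrite expr0.
by rewrite exprS IHn clsM; apply: cls_ext => i; rewrite exprS.
Qed.

Lemma clsMn x n : cls x *+ n = cls (fun i => x i *+ n).
Proof.
elim: n => [|n IHn]; first by rewrite mulr0n.
by rewrite mulrS IHn clsD; apply: cls_ext => i; rewrite mulrS.
Qed.

Lemma cls_sum (J : Type) (r : seq J) (F : J -> prodK) :
  \sum_(j <- r) cls (F j) = cls (fun i => \sum_(j <- r) F j i).
Proof.
elim: r => [|j r IHr].
  by rewrite big_nil; apply: cls_ext => i; rewrite big_nil.
by rewrite big_cons IHr clsD; apply: cls_ext => i; rewrite big_cons.
Qed.

Lemma cls_prod (J : Type) (r : seq J) (F : J -> prodK) :
  \prod_(j <- r) cls (F j) = cls (fun i => \prod_(j <- r) F j i).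
Proof.
elim: r => [|j r IHr].
  by rewrite big_nil; apply: cls_ext => i; rewrite big_nil.
by rewrite big_cons IHr clsM; apply: cls_ext => i; rewrite big_cons.
Qed.

Lemma cls_eq0 x : cls x = 0 <-> U (fun i => x i = 0).
Proof. by rewrite -cls0; apply: clsP. Qed.

Lemma cls_neq0 x : cls x != 0 <-> U (fun i => x i != 0).
Proof.
have -> : (cls x != 0) <-> ~ (cls x = 0) by split=> [/eqP|/eqP].
rewrite cls_eq0 -(uf_not hU).
by split; apply: (ufS hU) => i /eqP.
Qed.

Section MultivariateFibres.

Variable N : nat.
Implicit Type f : {mpoly UP[N]}.

(** A polynomial over the ultraproduct has finite support, so it is the class of a family of
    polynomials with supports inside that of f. *)
Definition mfib f i : {mpoly (K i)[N]} :=
  \sum_(m <- msupp f) rep f@_m i *: 'X_[m].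

Lemma mfib_coef f i m : (mfib f i)@_m = if m \in msupp f then rep f@_m i else 0.
Proof.
rewrite /mfib raddf_sum /=; case: ifPn => [mf|nmf].
  rewrite (bigD1_seq m) //= mcoeffZ mcoeffX eqxx mulr1 big1 ?addr0 // => k /negbTE ne.
  by rewrite mcoeffZ mcoeffX ne mulr0.
rewrite big_seq big1 // => k kf; rewrite mcoeffZ mcoeffX.
by case: eqP => [e|_]; [move: nmf; rewrite -e kf|rewrite mulr0].
Qed.

Lemma mfib_cls f m : f@_m = cls (fun i => (mfib f i)@_m).
Proof.
case: (boolP (m \in msupp f)) => [mf|nmf].
  by rewrite -[LHS]repK; apply: cls_ext => i; rewrite mfib_coef mf.
by rewrite memN_msupp_eq0 // -cls0; apply: cls_ext => i; rewrite mfib_coef (negbTE nmf).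
Qed.

Lemma mfib_supp f i m : m \in msupp (mfib f i) -> m \in msupp f.
Proof. by rewrite mcoeff_msupp mfib_coef; case: ifP; rewrite // eqxx. Qed.

Lemma mfib_meval f (x : 'I_N -> prodK) :
  f.@[fun j => cls (x j)] = cls (fun i => (mfib f i).@[fun j => x j i]).
Proof.
rewrite mevalE; under eq_bigr => m _.
  rewrite -[f@_m]repK; under eq_bigr => j _ do rewrite clsX.
  rewrite cls_prod clsM.
  over.
rewrite cls_sum; apply: cls_ext => i; rewrite /mfib raddf_sum /=.
by apply: eq_bigr => m _; rewrite mevalZ mevalX.
Qed.

Lemma mfib_neq0 f : f != 0 -> U (fun i => mfib f i != 0).
Proof.
rewrite -msupp_eq0; case E : (msupp f) => [//|m s] _.
have mf : m \in msupp f by rewrite E inE eqxx.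
move: (mf); rewrite mcoeff_msupp mfib_cls => /cls_neq0; apply: (ufS hU) => i.
by apply: contraNneq => ->; rewrite mcoeff0.
Qed.

End MultivariateFibres.

End Ultraproduct.

(** * Ultraproducts of models *)

Section Models.

Variables (p eps : nat) (mu : 'I_(p ^ eps) -> {ffun 'I_eps -> 'I_p}).

Record model := Model {
  mK :> fieldType;
  md : mK -> mK;
  ma : 'I_eps -> mK;
  ml : 'I_(p ^ eps) -> mK -> mK;
  mDF : is_DFl mu md ma ml;
  mSD : separably_diff_closed md }.

Definition mstr (M : model) : structure (Ldl p eps) :=
  Ldl_structure (@md M) (@ma M) (@ml M).

Hypothesis hp : prime p.
Hypothesis hmu : bijective mu.

Lemma constant_pmonomial (K : fieldType) (d : K -> K) (a : 'I_eps -> K) e :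
  is_derivation d -> (forall j, constant d (a j)) -> d (@pmonomial K p eps a e) = 0.
Proof.
move=> [dD dM] ca; rewrite /pmonomial; apply: (big_ind (fun z => d z = 0)).
- exact: der1.
- by move=> x y hx hy; rewrite dM hx hy mul0r mulr0 addr0.
- by move=> j _; rewrite (derX dM) ca mulr0 mul0rn.
Qed.

(** The p-monomials themselves witness the degree: they are independent over $K^p$, and the
    functions l give the coordinates of each constant. *)
Lemma is_DFl_intro (K : fieldType) (d : K -> K) (a : 'I_eps -> K)
    (l : 'I_(p ^ eps) -> K -> K) :
  is_derivation d -> p \in [pchar K] -> diff_p_independent p d a ->
  (forall b : K, (~ constant d b -> forall i, l i b = 0) /\
     (constant d b -> b = \sum_i l i b ^+ p * pmonomial a (mu i))) ->
  is_DFl mu d a l.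
Proof.
move=> dd pK ind hl; split=> //; have [ca li] := ind.
exists (fun i => pmonomial a (mu i)); split.
- by move=> i; apply: constant_pmonomial.
- move=> c hc E i; have [nu muK nuK] := hmu.
  have := li (fun e => c (nu e)) (fun e => hc (nu e)) _ (mu i).
  rewrite muK; apply; apply: etrans E; rewrite (reindex mu) /=; last by apply: onW_bij.
  by apply: eq_bigr => k _; rewrite muK.
- move=> x cx; exists (fun i => l i x ^+ p); last exact: (hl x).2.
  by move=> i; exists (l i x).
Qed.

Section UltraproductModel.

Variables (I : Type) (U : (I -> Prop) -> Prop) (hU : ultrafilter U).
Variable M : I -> model.

Local Notation UP := (uprod (fun i => M i : fieldType) hU).
Local Notation cl := (@cls _ _ (fun i => M i : fieldType) hU).

Definition up_d (z : UP) : UP := cl (fun i => md (rep z i)).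
Definition up_a (j : 'I_eps) : UP := cl (fun i => ma (M i) j).
Definition up_l (k : 'I_(p ^ eps)) (z : UP) : UP := cl (fun i => ml k (rep z i)).

Lemma up_dE x : up_d (cl x) = cl (fun i => md (x i)).
Proof. by apply/clsP; apply: ufS (rep_cls hU x) => // i ->. Qed.

Lemma up_lE k x : up_l k (cl x) = cl (fun i => ml k (x i)).
Proof. by apply/clsP; apply: ufS (rep_cls hU x) => // i ->. Qed.

Lemma iter_up_d j x : iter j up_d (cl x) = cl (fun i => iter j (@md (M i)) (x i)).
Proof. by elim: j => //= j ->; rewrite up_dE. Qed.

Lemma up_monomial e :
  pmonomial up_a e = cl (fun i => @pmonomial (M i) p eps (@ma (M i)) e).
Proof.
rewrite /pmonomial; under eq_bigr => j _ do rewrite clsX.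
by rewrite cls_prod.
Qed.

Lemma up_DFl : is_DFl mu up_d up_a up_l.
Proof.
have der i : is_derivation (@md (M i)) by case: (mDF (M i)).
have chr i : p \in [pchar (M i)] by case: (mDF (M i)).
have ind i : diff_p_independent p (@md (M i)) (@ma (M i)) by case: (mDF (M i)).
have hl i b : (~ constant (@md (M i)) b -> forall k, ml k b = 0) /\
   (constant (@md (M i)) b -> b = \sum_k ml k b ^+ p * pmonomial (@ma (M i)) (mu k)).
  by case: (mDF (M i)).
apply: is_DFl_intro.
- split=> a b; have [x ->] := cls_surj a; have [y ->] := cls_surj b.
    by rewrite clsD !up_dE clsD; apply: cls_ext => i; rewrite (der i).1.
  by rewrite clsM !up_dE !clsM clsD; apply: cls_ext => i; rewrite (der i).2.
- rewrite inE hp -cls1 clsMn /=; apply/eqP; rewrite -cls0; apply: cls_ext => i.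
  by rewrite (pcharf0 (chr i)).
- split=> [j|c hc E e].
    by rewrite /constant /up_a up_dE -cls0; apply: cls_ext => i; apply: (ind i).1.
  (* Choosing p-th roots of the coefficients turns a relation over p-th powers into relations of the
     same kind in almost all coordinates. *)
  have /boolp.choice[y yP] : forall e, exists y : UP, c e = y ^+ p by [].
  have cE e' : c e' = cl (fun i => rep (y e') i ^+ p) by rewrite -clsX repK.
  move: E; under eq_bigr => e' _ do rewrite cE up_monomial clsM.
  rewrite cls_sum => /cls_eq0 H; rewrite cE; apply/cls_eq0.
  apply: ufS H => // i H.
  apply: ((ind i).2 (fun e' => rep (y e') i ^+ p)) => // e'.
  by exists (rep (y e') i).
- move=> b; have [x ->] := cls_surj b; rewrite /constant up_dE; split.
    move=> nc k; rewrite up_lE; apply/cls_eq0.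
    have : U (fun i => ~ md (x i) = 0).
      by apply/(uf_not hU) => H; apply: nc; apply/cls_eq0.
    by apply: (ufS hU) => i nci; apply: (hl i _).1.
  move=> /cls_eq0 H.
  under eq_bigr => k _ do rewrite up_lE clsX up_monomial clsM.
  by rewrite cls_sum; apply/clsP; apply: ufS H => // i; apply: (hl i _).2.
Qed.

(** Nonzero coefficients of f, of g and of the separant stay nonzero in almost all fibres, while
    supports cannot grow. So almost every fibre is an instance of the axiom, and the solutions are
    assembled by [uf_choice]. *)
Lemma up_SD : separably_diff_closed up_d.
Proof.
move=> N f g n f0 g0 [[m0 m0f m0n] occf] sf occg.
have : U (fun i => exists x : M i,
    deval (@md (M i)) (mfib f i) x = 0 /\ deval (@md (M i)) (mfib g i) x != 0).
  have [m mf] : exists m, (f^`M(n))@_m != 0.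
    apply: contrapT => H; case/eqP: sf; apply/mpolyP => m; rewrite mcoeff0.
    by apply: contrapT => /eqP nz; apply: H; exists m.
  move: mf; rewrite mcoeff_deriv mfib_cls clsMn => /cls_neq0 Hsep.
  move: (m0f); rewrite mcoeff_msupp mfib_cls => /cls_neq0 Hm0.
  apply: ufS (ufI hU (ufI hU (mfib_neq0 f0) (mfib_neq0 g0)) (ufI hU Hsep Hm0)) => //.
  move=> i [[fi0 gi0] [sepi m0i]]; apply: (@mSD (M i) N (mfib f i) (mfib g i) n) => //.
  - split; first by exists m0; rewrite ?mcoeff_msupp.
    by move=> j [m' m'f m'j]; apply: occf; exists m' => //; apply: mfib_supp m'f.
  - by apply: contraNneq sepi => e; rewrite -mcoeff_deriv e mcoeff0.
  - by move=> j [m' m'g m'j]; apply: occg; exists m' => //; apply: mfib_supp m'g.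
move=> H.
have [x hx] := uf_choice hU H; exists (cl x).
have E (h : {mpoly UP[N]}) : deval up_d h (cl x) =
    cl (fun i => deval (@md (M i)) (mfib h i) (x i)).
  by rewrite /deval -mfib_meval; apply: meval_eq => j; rewrite iter_up_d.
rewrite !E; split; first by apply/cls_eq0; apply: ufS hx => // i [].
by apply/cls_neq0; apply: ufS hx => // i [].
Qed.

Definition up_model : model := Model up_DFl up_SD.

Lemma eval_up n (v : 'I_n -> forall i, M i) (t : term (Ldl p eps) n) :
  @eval _ (mstr up_model) n (fun k => cl (v k)) t =
  cl (fun i => @eval _ (mstr (M i)) n (fun k => v k i) t).
Proof.
elim: t => [k|f ts IHt] //=.
case: f ts IHt => [||||||| j|k] ts IHt //=.
- by rewrite !IHt clsD.
- by rewrite IHt clsN.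
- by rewrite !IHt clsM.
- by rewrite IHt clsV.
- by rewrite IHt up_dE.
- by rewrite IHt up_lE.
Qed.

Lemma scons_cls n (x : forall i, M i) (v : 'I_n -> forall i, M i) :
  scons (cl x) (fun k => cl (v k)) = (fun k => cl (scons x v k)).
Proof. by apply/funext => k; rewrite /scons; case: (unlift _ _). Qed.

Lemma scons_at n i (x : forall i, M i) (v : 'I_n -> forall i, M i) :
  (fun k => scons x v k i) = scons (x i) (fun k => v k i).
Proof. by apply/funext => k; rewrite /scons; case: (unlift _ _). Qed.

(** Induction on formulas. Connectives use that U is an ultrafilter, existence uses coordinatewise
    choice, and the universal quantifier is handled through a family of counterexamples. *)
Theorem Los n (phi : formula (Ldl p eps) n) (v : 'I_n -> forall i, M i) :
  @sat _ (mstr up_model) n phi (fun k => cl (v k)) <->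
  U (fun i => @sat _ (mstr (M i)) n phi (fun k => v k i)).
Proof.
elim: phi v => {n} [n t u|n|n A IHA B IHB|n A IHA B IHB|n A IHA B IHB|n A IHA|n A IHA] v /=.
- by rewrite !eval_up; apply: clsP.
- by split=> // /(uf0 hU).
- by rewrite IHA IHB; apply: iff_sym; apply: uf_and.
- by rewrite IHA IHB; apply: iff_sym; apply: uf_or.
- by rewrite IHA IHB; apply: iff_sym; apply: uf_imp.
- split=> [H|H z].
    apply: contrapT => /(uf_not hU) nH.
    have : U (fun i => exists x, ~ @sat _ (mstr (M i)) _ A (scons x (fun k => v k i))).
      by apply: ufS nH => // i /existsNP.
    move/(uf_choice hU) => [x /(uf_not hU)]; apply.
    have := H (cl x); rewrite scons_cls IHA.
    by apply: (ufS hU) => i; rewrite scons_at.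
  have [x ->] := cls_surj z; rewrite scons_cls IHA.
  by apply: ufS H => // i /(_ (x i)); rewrite scons_at.
- split=> [[z]|].
    have [x ->] := cls_surj z; rewrite scons_cls IHA.
    by apply: (ufS hU) => i H; exists (x i); rewrite -scons_at.
  move/(uf_choice hU) => [x H]; exists (cl x); rewrite scons_cls IHA.
  by apply: ufS H => // i; rewrite scons_at.
Qed.

End UltraproductModel.

End Models.

(** * Elementary extensions *)

Section ElementaryExtensions.

Variables (p eps : nat) (mu : 'I_(p ^ eps) -> {ffun 'I_eps -> 'I_p}).
Hypothesis hp : prime p.
Hypothesis hmu : bijective mu.

Local Notation model := (model mu).

Record elem_ext (M M' : model) := ElemExt {
  ej :> {rmorphism M -> M'};
  ed : forall x, md (ej x) = ej (md x);
  ea : forall k, ma M' k = ej (ma M k);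
  el : forall k x, ml k (ej x) = ej (ml k x);
  esat : forall n (phi : formula (Ldl p eps) n) (v : 'I_n -> M),
    @sat _ (mstr M) n phi v <-> @sat _ (mstr M') n phi (fun k => ej (v k)) }.

Definition elem_id (M : model) : elem_ext M M.
Proof. by exists (GRing.RMorphism.clone _ _ (@idfun M) _). Defined.

Definition elem_comp (M M' M'' : model) (e' : elem_ext M' M'') (e : elem_ext M M') :
  elem_ext M M''.
Proof.
exists (GRing.RMorphism.clone _ _ (e' \o e) _) => /=.
- by move=> x; rewrite !ed.
- by move=> k; rewrite (ea e') (ea e).
- by move=> k x; rewrite !el.
- by move=> n phi v; rewrite (esat e) (esat e').
Defined.

Section Ultrapower.

Variables (I : Type) (U : (I -> Prop) -> Prop) (hU : ultrafilter U).
Variable M : model.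

Local Notation UM := (up_model hp hmu hU (fun=> M)).
Local Notation cl := (@cls _ _ (fun=> M : fieldType) hU).

Definition diag (x : M) : UM := cl (fun=> x).

Fact diag_zmod_morphism : zmod_morphism diag.
Proof. by move=> x y; rewrite /diag clsN clsD. Qed.

Fact diag_monoid_morphism : monoid_morphism diag.
Proof. by split=> // x y; rewrite /diag clsM. Qed.

HB.instance Definition _ := GRing.isZmodMorphism.Build M UM diag diag_zmod_morphism.
HB.instance Definition _ := GRing.isMonoidMorphism.Build M UM diag diag_monoid_morphism.

Definition elem_diag : elem_ext M UM.
Proof.
exists (GRing.RMorphism.clone _ _ diag _) => /=.
- by move=> x; rewrite /diag /= up_dE.
- by [].
- by move=> k x; rewrite /diag /= up_lE.
- move=> n phi v; rewrite /diag.
  have := @Los p eps mu hp hmu I U hU (fun=> M) n phi (fun k _ => v k).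
  move=> ->; split=> [H|H]; first by apply: (ufT hU).
  apply: contrapT => nH; apply: (uf0 hU).
  by apply: ufS H.
Defined.

Lemma mmap_diag N (P : {mpoly M[N]}) (x : I -> M) :
  mmap elem_diag (fun j : 'I_N => iter j (@md _ _ _ UM) (cl x)) P =
  cl (fun i => deval (@md _ _ _ M) P (x i)).
Proof.
rewrite /mmap; under eq_bigr => m _.
  rewrite /mmap1; under eq_bigr => j _ do rewrite [iter _ _ _](iter_up_d hU) clsX.
  rewrite cls_prod [ej _ _]/(cl _) clsM.
  over.
by rewrite cls_sum; apply: cls_ext => i; rewrite /deval mevalE.
Qed.

End Ultrapower.

(** Compactness: the ultrapower is indexed by finite lists of inequations, and the ultrafilter
    contains, for each inequation, the set of lists mentioning it. The class of the solutions found
    for the lists then satisfies everything at once. *)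
Lemma elem_realize (M : model) (Z NZ : {N & {mpoly M[N]}} -> Prop) :
  (forall s : seq {N & {mpoly M[N]}}, (forall q, List.In q s -> NZ q) ->
    exists x : M, (forall q, Z q -> deval (@md _ _ _ M) (projT2 q) x = 0) /\
      forall q, List.In q s -> deval (@md _ _ _ M) (projT2 q) x != 0) ->
  exists (M' : model) (e : elem_ext M M') (x : M'),
    (forall q, Z q -> mmap e (fun j => iter (nat_of_ord j) (@md _ _ _ M') x) (projT2 q) = 0) /\
    (forall q, NZ q -> mmap e (fun j => iter (nat_of_ord j) (@md _ _ _ M') x) (projT2 q) != 0).
Proof.
move=> H; pose J := {q | NZ q}.
have /boolp.choice[x xP] : forall s : seq J, exists x : M,
    (forall q, Z q -> deval (@md _ _ _ M) (projT2 q) x = 0) /\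
    forall q : J, List.In q s -> deval (@md _ _ _ M) (projT2 (sval q)) x != 0.
  move=> s; have [q|x [hZ hN]] := H (map sval s).
    by move=> /List.in_map_iff[q' [<- _]]; case: q'.
  by exists x; split=> // q qs; apply: hN; apply: List.in_map.
have [U [hU UJ]] := ultrafilter_seq J.
exists (up_model hp hmu hU (fun=> M)), (elem_diag hU M), (cls hU x); split=> q hq.
  rewrite mmap_diag; apply/cls_eq0; apply: (ufT hU) => s.
  exact: (xP s).1.
rewrite mmap_diag; apply/cls_neq0; apply: ufS (UJ (exist _ q hq)) => // s.
by move=> /(xP s).2.
Qed.

(** * Generic solutions of differential equations in elementary extensions *)

Section Solve.

Variable M : model.
Local Notation dv := (deval (@md _ _ _ M)).

Lemma deval_mwiden N (g : {mpoly M[N]}) x : dv (mwiden g) x = dv g x.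
Proof. exact: (ev_mwiden idfun (fun i => iter i (@md _ _ _ M) x) g). Qed.

Lemma devalM N (g h : {mpoly M[N]}) x : dv (g * h) x = dv g x * dv h x.
Proof. exact: mevalM. Qed.

Lemma deval_widen N N' (g : {mpoly M[N]}) : (N <= N')%N -> g != 0 ->
  exists2 g' : {mpoly M[N']}, g' != 0 & forall x, dv g' x = dv g x.
Proof.
move/subnK <-; elim: (N' - N)%N => [|k IHk] g0; first by exists g.
have [g' g'0 E] := IHk g0; exists (mwiden g').
  by rewrite -[0](raddf0 (@mwiden _ _)) (inj_eq (@inj_mwiden _ _)).
by move=> x; rewrite deval_mwiden.
Qed.

(** A nonzero derivative in the last variable forces the order of f to be exactly n, and the widened
    g does not contain that variable. *)
Lemma solve_sep n (f : {mpoly M[n.+1]}) (g : {mpoly M[n]}) :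
  f^`M(ord_max) != 0 -> g != 0 -> exists x : M, dv f x = 0 /\ dv g x != 0.
Proof.
move=> sf g0.
have f0 : f != 0 by apply: contraNneq sf => ->; rewrite mderiv0.
have wg0 : mwiden g != 0.
  by rewrite -[0](raddf0 (@mwiden _ _)) (inj_eq (@inj_mwiden _ _)).
have [||x [h1 h2]] := @mSD _ _ _ M _ _ _ ord_max f0 wg0 _ sf; last 1 first.
- by exists x; split=> //; rewrite -(deval_mwiden g).
- split; last by move=> j _; rewrite -ltnS ltn_ord.
  have [m mf] : exists m, (f^`M(ord_max))@_m != 0.
    apply: contrapT => H; case/eqP: sf; apply/mpolyP => m; rewrite mcoeff0.
    by apply: contrapT => /eqP nz; apply: H; exists m.
  exists (m + U_(ord_max))%MM; last by rewrite mnmDE mnmE eqxx addn1.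
  rewrite mcoeff_msupp; apply: contraNneq mf.
  by rewrite mcoeff_deriv => ->; rewrite mul0rn.
- move=> j [m mg mj]; rewrite ltn_neqAle -ltnS ltn_ord andbT.
  apply: contraTneq mg => /val_inj e; rewrite mcoeff_msupp negbK.
  by rewrite mwiden_coef0 // -e.
Qed.

Lemma product_nonzero n (s : seq {N & {mpoly M[N]}}) :
  (forall q, List.In q s -> exists2 g : {mpoly M[n]}, g != 0 & q = existT _ n g) ->
  exists2 g : {mpoly M[n]}, g != 0 & forall x, dv g x != 0 ->
    forall q, List.In q s -> dv (projT2 q) x != 0.
Proof.
elim: s => [|q s IHs] hs; first by exists 1; rewrite ?oner_neq0.
have [g g0 Hg] := IHs (fun q' h => hs q' (or_intror h)).
have [h h0 E] := hs q (or_introl erefl).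
exists (h * g); first exact: mulf_neq0.
move=> x; rewrite devalM mulf_eq0 negb_or => /andP[hx gx] q' [<-|/Hg]; last exact.
by rewrite E.
Qed.

Lemma product_nonzero_any (s : seq {N & {mpoly M[N]}}) :
  (forall q, List.In q s -> projT2 q != 0) ->
  exists N (g : {mpoly M[N]}), g != 0 /\ forall x, dv g x != 0 ->
    forall q, List.In q s -> dv (projT2 q) x != 0.
Proof.
elim: s => [|[N h] s IHs] hs; first by exists 0%N, 1; rewrite oner_neq0.
have [N' [g [g0 Hg]]] := IHs (fun q' h => hs q' (or_intror h)).
have h0 : h != 0 := hs _ (or_introl erefl).
have [h' h'0 Eh] := deval_widen (leq_maxl N N') h0.
have [g' g'0 Eg] := deval_widen (leq_maxr N N') g0.
exists (maxn N N'), (h' * g'); split; first exact: mulf_neq0.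
move=> x; rewrite devalM mulf_eq0 negb_or => /andP[hx gx] q' [<-|] /=.
  by rewrite -Eh.
by apply: Hg; rewrite -Eg.
Qed.

(** Finitely many inequations in n variables merge into their product, so that [solve_sep] handles
    each finite part. *)
Lemma elem_generic_sep n (f : {mpoly M[n.+1]}) : f^`M(ord_max) != 0 ->
  exists (M' : model) (e : elem_ext M M') (x : M'),
    mmap e (fun j => iter (nat_of_ord j) (@md _ _ _ M') x) f = 0 /\
    alg_indep e (fun j => iter j (@md _ _ _ M') x) n.
Proof.
move=> sf.
pose Z q := q = existT (fun N => {mpoly M[N]}) _ f.
pose NZ q := exists2 g : {mpoly M[n]}, g != 0 & q = existT (fun N => {mpoly M[N]}) n g.
have [s hs|M' [e [x [hZ hN]]]] := @elem_realize M Z NZ.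
  have [g g0 Hg] := product_nonzero hs; have [x [fx gx]] := solve_sep sf g0.
  by exists x; split; [move=> q -> | apply: Hg].
exists M', e, x; split; first exact: (hZ (existT _ _ f)).
move=> g gx; apply: contrapT => /eqP g0.
by have := hN (existT _ n g) (ex_intro2 _ _ g g0 erefl); rewrite /= gx eqxx.
Qed.

Lemma elem_generic : exists (M' : model) (e : elem_ext M M') (x : M'),
  forall N, alg_indep e (fun j => iter j (@md _ _ _ M') x) N.
Proof.
have [s hs|M' [e [x [_ hN]]]] :=
    @elem_realize M (fun=> False) (fun q => projT2 q != 0).
  have [N [g [g0 Hg]]] := product_nonzero_any hs.
  (* The inequation g != 0 is solved jointly with the auxiliary equation $\delta^N x = 0$, whose
     separant is 1. *)
  have sX : ('X_ord_max : {mpoly M[N.+1]})^`M(ord_max) != 0.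
    rewrite mderivX mnmE eqxx scale1r; apply/eqP => /(congr1 (fun q => q@_0%MM)).
    rewrite mcoeffX mcoeff0; case: eqP => [_ /eqP|ne _]; first by rewrite oner_eq0.
    by apply: ne; apply/mnmP => k; rewrite mnmBE subnn mnmE.
  by have [x [_ gx]] := solve_sep sX g0; exists x; split=> //; apply: Hg.
exists M', e, x => N g gx; apply: contrapT => /eqP g0.
by have := hN (existT _ N g) g0; rewrite /= gx eqxx.
Qed.

End Solve.

End ElementaryExtensions.

(** * Partial isomorphisms as subfields of a product *)

(* A subfield of the ring K * L is the graph of an isomorphism between a subfield of
   K and a subfield of L. *)
Section PairSubfields.

Variables K L : fieldType.
Local Notation R := (K * L)%type.
Implicit Types (G : R -> Prop) (z : R).

Definition dom G (k : K) := exists l, G (k, l).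

Lemma pair_unitE z : (z \is a GRing.unit) = (z.1 != 0) && (z.2 != 0).
Proof. by rewrite -!unitfE. Qed.

Lemma pair_invE z : z.1 != 0 -> z.2 != 0 -> z^-1 = (z.1^-1, z.2^-1).
Proof.
move=> h1 h2; apply: mulr1_eq; case: z h1 h2 => a b /= h1 h2.
by congr (_, _); rewrite /= mulfV.
Qed.

Section Graph.

Variable G : R -> Prop.
Hypothesis hG : is_subfield G.

Lemma graph_fst0 z : G z -> z.1 = 0 -> z = 0.
Proof.
move=> Gz z0; apply/eqP; apply/negPn/negP => nz; have := sfU hG Gz nz.
by rewrite pair_unitE z0 eqxx.
Qed.

Lemma graph_neq0 z : G z -> z != 0 -> (z.1 != 0) /\ (z.2 != 0).
Proof. by move=> Gz /(sfU hG Gz); rewrite pair_unitE => /andP[]. Qed.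

Lemma graph_eq k l l' : G (k, l) -> G (k, l') -> l = l'.
Proof.
move=> H H'; have /(graph_fst0 (sfB hG H H')) : (k, l).1 - (k, l').1 = 0 by rewrite subrr.
by move/(congr1 snd)/eqP; rewrite subr_eq0 => /eqP.
Qed.

Lemma dom_subfield : is_subfield (dom G).
Proof.
split.
- by exists 1; apply: (sf1 hG).
- by move=> x y [l H] [l' H']; exists (l - l'); apply: (sfB hG H H').
- by move=> x y [l H] [l' H']; exists (l * l'); apply: (sfM hG H H').
- move=> x [l H]; have [x0|x0] := eqVneq x 0.
    by rewrite x0 invr0 -x0; exists l.
  have nz : (x, l) != 0 by apply: contraNneq x0 => /(congr1 fst) /= ->.
  have [h1 h2] := graph_neq0 H nz.
  by exists l^-1; have := sfV hG H; rewrite pair_invE.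
- by move=> x _ x0; rewrite unitfE.
Qed.

Lemma pover_map_neq0 (P : {poly R}) : poly_over G P -> P != 0 ->
  map_poly fst P != 0 /\ map_poly snd P != 0.
Proof.
move=> GP P0; have l0 : lead_coef P != 0 by rewrite lead_coef_eq0.
have [h1 h2] := graph_neq0 (GP _) l0.
split.
  apply: contraNneq h1 => /(congr1 (fun q : {poly K} => q`_(size P).-1)).
  by rewrite coef_map coef0 => /eqP.
apply: contraNneq h2 => /(congr1 (fun q : {poly L} => q`_(size P).-1)).
by rewrite coef_map coef0 => /eqP.
Qed.

Lemma pover_lift (P : {poly K}) : poly_over (dom G) P ->
  exists2 Q : {poly R}, poly_over G Q & map_poly fst Q = P.
Proof.
move=> hP; have /boolp.choice[l hl] : forall i, exists l, G (P`_i, l) by [].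
exists (\poly_(i < size P) (P`_i, l i)).
  by move=> i; rewrite coef_poly; case: ifP => // _; apply: sf0 hG.
apply/polyP => i; rewrite coef_map coef_poly /=.
by case: ltnP => // le; rewrite /= nth_default.
Qed.

End Graph.

Variables (x : nat -> K) (y : nat -> L).
Let z i : R := (x i, y i).

Lemma horner_fst (P : {poly R}) i : (P.[z i]).1 = (map_poly fst P).[x i].
Proof. by have := horner_map fst P (z i). Qed.

Lemma horner_snd (P : {poly R}) i : (P.[z i]).2 = (map_poly snd P).[y i].
Proof. by have := horner_map snd P (z i). Qed.

Lemma chain_fst G n e : chain G z n e -> chain (dom G) x n e.1.
Proof.
elim: n e => [|n IHn] e /=; first by case: e => k l H; exists l.
move=> [P [Q [GP GQ uQ E]]]; exists (map_poly fst P), (map_poly fst Q); split.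
- by move=> i; rewrite coef_map; apply: IHn.
- by move=> i; rewrite coef_map; apply: IHn.
- by rewrite -horner_fst unitfE; move: uQ; rewrite pair_unitE => /andP[].
- by rewrite -!horner_fst -E.
Qed.

Lemma chain_snd G (B : L -> Prop) n e : (forall g, G g -> B g.2) ->
  chain G z n e -> chain B y n e.2.
Proof.
move=> GB; elim: n e => [|n IHn] e /=; first exact: GB.
move=> [P [Q [GP GQ uQ E]]]; exists (map_poly snd P), (map_poly snd Q); split.
- by move=> i; rewrite coef_map; apply: IHn.
- by move=> i; rewrite coef_map; apply: IHn.
- by rewrite -horner_snd unitfE; move: uQ; rewrite pair_unitE => /andP[].
- by rewrite -!horner_snd -E.
Qed.

(** Coefficients are lifted to the graph by choice. The lifted denominator is a unit, since
    otherwise it would be 0 and so would its first component. *)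
Lemma chain_lift G n k : is_subfield G ->
  (forall i, (i < n)%N -> unital_at (chain G z i) (z i)) ->
  chain (dom G) x n k -> dom (chain G z n) k.
Proof.
move=> hG; elim: n k => [//|n IHn] k hz [P [Q [hP hQ uQ E]]].
have hC : is_subfield (chain G z n).
  by apply: chain_subfield => // i lt; apply: hz; apply: ltnW.
have lift T : poly_over (chain (dom G) x n) T -> poly_over (dom (chain G z n)) T.
  by move=> hT i; apply: IHn => // j lt; apply: hz; apply: ltnW.
have [P' hP' EP] := pover_lift hC (lift _ hP).
have [Q' hQ' EQ] := pover_lift hC (lift _ hQ).
have uQ' : Q'.[z n] \is a GRing.unit.
  case: (hz n (ltnSn n) Q' hQ') => // /(congr1 fst) /=; rewrite horner_fst EQ => Q0.
  by move: uQ; rewrite Q0 unitr0.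
exists (P'.[z n] * Q'.[z n]^-1).2, P', Q'; split=> //.
have e1 : (P'.[z n] * Q'.[z n]^-1).1 = k.
  have u1 : (Q'.[z n]).1 \is a GRing.unit by rewrite horner_fst EQ.
  apply: (mulIr u1); rewrite -[LHS]/((P'.[z n] * Q'.[z n]^-1 * Q'.[z n]).1).
  by rewrite divrK // !horner_fst EP EQ E.
by rewrite -e1; case E2 : (_ * _) => [a b] /=; rewrite -E2 divrK.
Qed.

(** A nonzero polynomial over a graph has two nonzero projections. With generators transcendental on
    both sides, neither component of its value vanishes, so the value is a unit. *)
Lemma chain_transc_unital G (B : L -> Prop) n : is_subfield G ->
  (forall g, G g -> B g.2) ->
  (forall i, (i < n)%N -> transc (chain (dom G) x i) (x i)) ->
  (forall i, (i < n)%N -> transc (chain B y i) (y i)) ->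
  forall i, (i < n)%N -> unital_at (chain G z i) (z i).
Proof.
move=> hG GB tx ty i; elim/ltn_ind: i => i IHi lt P hP.
have hC : is_subfield (chain G z i).
  by apply: chain_subfield => // j ltj; apply: IHi => //; apply: ltn_trans ltj lt.
have [->|P0] := eqVneq P 0; first by left; rewrite horner0.
right; have [h1 h2] := pover_map_neq0 hC hP P0.
rewrite pair_unitE horner_fst horner_snd; apply/andP; split.
  apply: contraNneq h1 => h; apply/eqP; apply: (tx i lt) => // j.
  by rewrite coef_map; apply: chain_fst.
apply: contraNneq h2 => h; apply/eqP; apply: (ty i lt) => // j.
by rewrite coef_map; apply: chain_snd GB _.
Qed.

End PairSubfields.

Section PairMap.

Variables (K K' L L' : fieldType) (f : {rmorphism K -> K'}) (g : {rmorphism L -> L'}).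

Definition pmap (z : K * L) : K' * L' := (f z.1, g z.2).

Fact pmap_zmod_morphism : zmod_morphism pmap.
Proof. by move=> [a b] [a' b']; rewrite /pmap /= !rmorphB. Qed.

Fact pmap_monoid_morphism : monoid_morphism pmap.
Proof.
split; first by rewrite /pmap /= !rmorph1.
by move=> [a b] [a' b']; rewrite /pmap /= !rmorphM.
Qed.

HB.instance Definition _ :=
  GRing.isZmodMorphism.Build (K * L)%type (K' * L')%type pmap pmap_zmod_morphism.
HB.instance Definition _ :=
  GRing.isMonoidMorphism.Build (K * L)%type (K' * L')%type pmap pmap_monoid_morphism.

Definition transport (G : K * L -> Prop) (z' : K' * L') := exists2 z, G z & z' = pmap z.

Lemma transport_subfield G : is_subfield G -> is_subfield (transport G).
Proof.
move=> hG; split.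
- by exists 1; [exact: sf1|rewrite rmorph1].
- by move=> _ _ [a Ga ->] [b Gb ->]; exists (a - b); [exact: sfB|rewrite rmorphB].
- by move=> _ _ [a Ga ->] [b Gb ->]; exists (a * b); [exact: sfM|rewrite rmorphM].
- move=> _ [a Ga ->]; have [->|a0] := eqVneq a 0.
    by rewrite rmorph0 invr0; exists 0; [exact: sf0|rewrite rmorph0].
  exists a^-1; first exact: sfV.
  by rewrite rmorphV //; apply: (sfU hG).
- move=> _ [a Ga ->] na; apply: rmorph_unit; apply: (sfU hG) => //.
  by apply: contraNneq na => ->; rewrite rmorph0.
Qed.

Lemma dom_transport G k' : dom (transport G) k' <-> exists2 k, dom G k & k' = f k.
Proof.
split=> [[l' [[k l] Gkl] [-> _]]|[k [l Gkl] ->]]; first by exists k => //; exists l.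
by exists (g l), (k, l).
Qed.

End PairMap.

(** * Transferring a separable equation along a graph *)

Section SeparableLift.

Variables (K L : fieldType) (G : K * L -> Prop) (x : nat -> K) (n : nat) (f : {poly K}).
Hypothesis hG : is_subfield G.
Hypothesis hf : sep_alg (dom G) x n f.

Local Notation R := (K * L)%type.
Local Notation ev1 := (mmap fst (fun j => x (nat_of_ord j))).

(* The equation f = 0 with denominators cleared, with coefficients in G. *)
Lemma sep_equation : exists (c : {poly {mpoly R[n]}}) (b : K),
  [/\ forall i, mpoly_over G c`_i, b != 0, b *: f = map_poly ev1 c &
      (map_mpoly snd (mmulti c))^`M(ord_max) != 0].
Proof.
have [mf Ff fx minf f'x] := hf.
have [D [c [hc D0 E]]] := @common_denominator R G K fst x (sf1 hG) (sfB hG) (sfM hG) n f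
  (fun j => @mfrac_chain R G K fst x (sf1 hG) (sfB hG) (sfM hG) n (dom G)
     (fun k '(ex_intro l H) => ex_intro2 _ _ (k, l) H erefl) _ (Ff j)).
exists c, (ev1 D); split=> //.
have e1 : ev1 (mmulti c)^`M(ord_max) != 0.
  rewrite (ev_mderiv_mmulti fst x c) -E derivZ hornerZ mulf_neq0 //.
have [m nz] : exists m, ((mmulti c)^`M(ord_max))@_m != 0.
  apply: contrapT => H; case/eqP: e1; suff -> : (mmulti c)^`M(ord_max) = 0 by rewrite mmap0.
  apply/mpolyP => m; rewrite mcoeff0.
  by apply: contrapT => /eqP h; apply: H; exists m.
apply/eqP => /(congr1 (mcoeff m)).
rewrite mcoeff0 mcoeff_deriv mcoeff_map_mpoly -raddfMn -mcoeff_deriv.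
(* The coefficient lies in G, where nonzero elements have nonzero second component, so the separant
   survives the passage to L. *)
have Gm : G ((mmulti c)^`M(ord_max))@_m.
  rewrite mcoeff_deriv; apply: sfMn => //.
  exact: (mpolyover_mmulti (sf1 hG) (sfB hG) (sfM hG) hc).
by have [_ /eqP] := graph_neq0 hG Gm nz.
Qed.

Variables (L' : fieldType) (e : {rmorphism L -> L'}) (y : nat -> L').
Variables (c : {poly {mpoly R[n]}}) (b : K).
Hypothesis hc : forall i, mpoly_over G c`_i.
Hypothesis b0 : b != 0.
Hypothesis bf : b *: f = map_poly ev1 c.
Hypothesis cy : mmap e (fun j => y (nat_of_ord j)) (map_mpoly snd (mmulti c)) = 0.

Let phi : {rmorphism R -> (K * L')%type} := pmap (@idfun K) e.
Let G0 := transport (@idfun K) e G.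
Let z i : K * L' := (x i, y i).

Hypothesis uz : forall i, (i < n)%N -> unital_at (chain G0 z i) (z i).

(** Evaluating [c] in both coordinates gives a polynomial g over the graph with first projection b
    f; it vanishes at [z n] because both components do. Minimality of f feeds [minimal_unital] with
    [fst] as the map to a field, and g' has a unit value since its first component is b f'(x_n). *)
Lemma sep_unital : unital_at (chain G0 z n) (z n) /\
  exists g, [/\ poly_over (chain G0 z n) g, g.[z n] = 0 &
    g^`().[z n] \is a GRing.unit].
Proof.
have [mf Ff fx minf f'x] := hf.
have hG0 : is_subfield G0 by apply: transport_subfield.
have hC : is_subfield (chain G0 z n) by apply: chain_subfield.
have domG0 k : dom G0 k -> dom G k by move/dom_transport => [k' H ->].
pose g := map_poly (mmap phi (fun j => z (nat_of_ord j))) c.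
have gi i : g`_i = mmap phi (fun j => z (nat_of_ord j)) c`_i.
  by rewrite coef_map_id0 ?rmorph0.
have hg : poly_over (chain G0 z n) g.
  move=> i; rewrite gi; apply: (mmap_over (G := G)) => //.
  - exact: sf0.
  - exact: sf1.
  - exact: sfD.
  - exact: sfM.
  - move=> s Gs; apply: (@chain_mono _ G0 z 0 n) => //; by exists s.
  - by move=> j lt; apply: chain_gen.
  - exact: hc.
have g1 : map_poly fst g = b *: f.
  rewrite bf; apply/polyP => i; rewrite coef_map gi [RHS]coef_map_id0 ?rmorph0 //.
  exact: (rmorph_mmap phi fst _ c`_i).
have gz : g.[z n] = 0.
  have E := ev_mmulti phi z c; rewrite -/g in E.
  have h1 : g.[z n].1 = 0 by rewrite horner_fst g1 hornerZ fx mulr0.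
  have h2 : g.[z n].2 = 0.
    rewrite -E; apply: etrans cy; rewrite (mmap_map_mpoly snd e).
    exact: (rmorph_mmap phi snd _ (mmulti c)).
  by case: (g.[z n]) h1 h2 => a a' /= -> ->.
have f0 : f != 0 by apply: monic_neq0.
(* Elements of a graph are determined by their first component, so g has no terms beyond those of b
   f. *)
have sg : size g = size f.
  apply/eqP; rewrite eqn_leq; apply/andP; split.
    apply/leq_sizeP => i le; apply: (graph_fst0 hC (hg i)).
    have := congr1 (fun q : {poly K} => q`_i) g1.
    by rewrite coef_map coefZ [f`_i]nth_default // mulr0.
  rewrite -(size_scale f b0) -g1; exact: size_poly.
have lg1 : (lead_coef g).1 = b.
  have := congr1 (fun q : {poly K} => q`_(size f).-1) g1.
  rewrite coef_map coefZ -/(lead_coef f) (monicP mf) mulr1 => <-.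
  by rewrite /lead_coef sg.
have ul : lead_coef g \is a GRing.unit.
  by apply: (sfU hC); [exact: hg|apply: contraNneq b0 => h; rewrite -lg1 h].
have Fl : chain G0 z n (lead_coef g)^-1 by apply: sfV => //; apply: hg.
pose g' := (lead_coef g)^-1 *: g.
have sg' : size g' = size f.
  by rewrite lreg_size //; apply: mulrI; rewrite unitrV.
have mg' : g' \is monic.
  by rewrite monicE /lead_coef sg' coefZ -sg -/(lead_coef g) mulVr.
have hg' : poly_over (chain G0 z n) g' by apply: poverZ.
have uzn : unital_at (chain G0 z n) (z n).
  apply: (@minimal_unital _ K fst (chain G0 z n) (z n) g') => //.
    by rewrite hornerZ gz mulr0.
  move=> P hP P0 h; have Px : (map_poly fst P).[x n] = 0.
    exact: etrans (esym (horner_fst x y P n)) h.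
  rewrite sg'.
  have [P1 _] := pover_map_neq0 hC hP P0.
  apply: leq_trans (minf _ _ P1 Px) (size_poly _ _) => i.
  rewrite coef_map /=; have := chain_fst (hP i).
  apply: chain_min; last first.
  + by move=> j lt; apply: chain_gen => // *; try exact: dom_subfield; apply: unital_field.
  + move=> k /domG0; apply: (@chain_mono _ _ x 0 n) => //; first exact: dom_subfield.
    by move=> *; apply: unital_field.
  + apply: chain_subfield; first exact: dom_subfield.
    by move=> *; apply: unital_field.
split=> //; exists g; split=> //.
case: (uzn _ (pover_deriv hC hg)) => // /(congr1 fst) /=; rewrite horner_fst -deriv_map g1.
by rewrite derivZ hornerZ => /eqP; rewrite mulf_eq0 (negbTE b0) (negbTE f'x).
Qed.

End SeparableLift.

(** * Extending partial isomorphisms *)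

Section Game.

Variables (p eps : nat) (mu : 'I_(p ^ eps) -> {ffun 'I_eps -> 'I_p}).
Hypothesis hp : prime p.
Hypothesis hmu : bijective mu.

Local Notation model := (model mu).

Section ModelFacts.

Variable M : model.

Lemma model_dD (x y : M) : md (x + y) = md x + md y.
Proof. by case: (mDF M) => [[dD _] _ _ _ _]; apply: dD. Qed.

Lemma model_dM (x y : M) : md (x * y) = md x * y + x * md y.
Proof. by case: (mDF M) => [[_ dM] _ _ _ _]; apply: dM. Qed.

Lemma model_pchar : p \in [pchar M].
Proof. by case: (mDF M). Qed.

Lemma model_l0 (b : M) i : md b <> 0 -> ml i b = 0.
Proof. by case: (mDF M) => _ _ _ _ /(_ b)[h _] /h. Qed.

Definition mono i : M := pmonomial (@ma _ _ _ M) (mu i).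

Lemma model_lE (b : M) : md b = 0 -> b = \sum_i ml i b ^+ p * mono i.
Proof. by case: (mDF M) => _ _ _ _ /(_ b)[_ h] /h. Qed.

Lemma model_indep (h : 'I_(p ^ eps) -> M) :
  \sum_i h i ^+ p * mono i = 0 -> forall i, h i = 0.
Proof.
case: (mDF M) => _ _ _ [_ li] _ E i; have [nu muK nuK] := hmu.
have H : \sum_e h (nu e) ^+ p * pmonomial (@ma _ _ _ M) e = 0.
  apply: etrans E; rewrite (reindex mu) /=; last exact: onW_bij.
  by apply: eq_bigr => k _; rewrite muK.
have /(_ (mu i)) := li (fun e => h (nu e) ^+ p) (fun e => ex_intro _ (h (nu e)) erefl) H.
by rewrite muK => /eqP; rewrite expf_eq0 => /andP[_ /eqP].
Qed.

End ModelFacts.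

Lemma elem_mono (M M' : model) (e : elem_ext M M') i : mono M' i = e (mono M i).
Proof.
rewrite /mono /pmonomial rmorph_prod; apply: eq_bigr => j _.
by rewrite rmorphXn (ea e).
Qed.

Definition dpair (M N : model) (z : M * N) : M * N := (md z.1, md z.2).

Lemma dpairD (M N : model) (z w : M * N) : dpair (z + w) = dpair z + dpair w.
Proof. by rewrite /dpair /= !model_dD. Qed.

Lemma dpairM (M N : model) (z w : M * N) :
  dpair (z * w) = dpair z * w + z * dpair w.
Proof. by rewrite /dpair /= !model_dM. Qed.

Record graph (M N : model) (G : M * N -> Prop) : Prop := Graph {
  gr_sf : is_subfield G;
  gr_d : forall z, G z -> G (dpair z);
  gr_a : forall k, G (ma M k, ma N k) }.

(** Coordinates with respect to the p-monomials are unique, so this is closure of the domain under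
    the functions l on constants, in a form that speaks of fields only. *)
Definition lclosed (M N : model) (G : M * N -> Prop) :=
  forall c, dom G c -> md c = 0 -> pspan p (mono M) (dom G) c.

Section Transport.

Variables (M M' N N' : model) (f : elem_ext M M') (g : elem_ext N N').
Variable G : M * N -> Prop.

Lemma graph_transport : graph G -> graph (transport f g G).
Proof.
move=> [hG dG aG]; split.
- exact: transport_subfield.
- move=> _ [z Gz ->]; exists (dpair z); first exact: dG.
  by rewrite /dpair /pmap /= !ed.
- by move=> k; exists (ma M k, ma N k); rewrite // /pmap /= (ea f) (ea g).
Qed.

Lemma lclosed_transport : lclosed G -> lclosed (transport f g G).
Proof.
move=> lG c' /dom_transport[c Gc ->]; rewrite ed => /eqP; rewrite fmorph_eq0 => /eqP dc.
have [h Gh E] := lG c Gc dc; exists (fun i => f (h i)).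
  by move=> i; apply/dom_transport; exists (h i).
rewrite {1}E rmorph_sum; apply: eq_bigr => i _.
by rewrite rmorphM rmorphXn (elem_mono f).
Qed.

End Transport.

Section OneElement.

Variables (M N : model) (G : M * N -> Prop) (x : M).
Hypothesis gG : graph G.

Local Notation X := (fun i => iter i (@md _ _ _ M) x).

Let hG := gr_sf gG.

Lemma dom_der c : dom G c -> dom G (md c).
Proof. by move=> [l Gcl]; exists (md l); apply: (gr_d gG Gcl). Qed.

Definition extends (N' : model) (e : elem_ext N N') (G' : M * N' -> Prop) :=
  forall z, G z -> G' (z.1, e z.2).

Section Step.

Variables (N' : model) (e : elem_ext N N') (y : N').
Let Y i := iter i (@md _ _ _ N') y.
Let Z i : M * N' := (X i, Y i).
Let G0 := transport (elem_id M) e G.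

Let gG0 : graph G0. Proof. exact: graph_transport. Qed.

Lemma dom_G0 : dom G0 = dom G.
Proof.
apply/funext => c; apply/propext; rewrite dom_transport.
by split=> [[k H ->]|H]; last by exists c.
Qed.

Lemma G0_snd g : G0 g -> exists b, g.2 = e b.
Proof. by move=> [z _ ->]; exists z.2. Qed.

Lemma G0_ext z : G z -> G0 (z.1, e z.2).
Proof. by exists z. Qed.

Lemma Z_unital n : (forall i, (i < n)%N -> transc (chain (dom G) X i) (X i)) ->
  alg_indep e Y n -> forall i, (i < n)%N -> unital_at (chain G0 Z i) (Z i).
Proof.
move=> tx ind; apply: (chain_transc_unital (B := fun l => exists b, l = e b)).
- exact: gr_sf gG0.
- exact: G0_snd.
- by rewrite dom_G0.
- by move=> i lt; apply: alg_indep_transc (alg_indep_le lt ind).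
Qed.

End Step.

(** The partner of x is a generic element over N, and closedness is preserved by [chain_pspan]. The
    new domain is recorded exactly, because [primitive_element] works over a field of this shape. *)
Lemma ext_transc : lclosed G -> (forall n, transc (chain (dom G) X n) (X n)) ->
  exists (N' : model) (e : elem_ext N N') (G' : M * N' -> Prop),
  [/\ graph G', lclosed G', extends e G', dom G' x &
      dom G' = chain_union (dom G) X].
Proof.
move=> lG tx; have [N' [e [y ind]]] := elem_generic hp hmu N.
pose G0 := transport (elem_id M) e G.
pose Z i : M * N' := (X i, iter i (@md _ _ _ N') y).
have hG0 : graph G0 by apply: graph_transport.
have uz i : unital_at (chain G0 Z i) (Z i).
  by apply: (Z_unital (n := i.+1)).
have hG' : is_subfield (chain_union G0 Z).
  by apply: chain_union_subfield => //; apply: gr_sf hG0.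
have domE : dom (chain_union G0 Z) = chain_union (dom G) X.
  apply/funext => c; apply/propext; split=> [[l [n H]]|[n H]].
    by exists n; have := chain_fst H; rewrite (dom_G0 e).
  have [||l H'] := @chain_lift _ _ X (fun i => iter i (@md _ _ _ N') y) G0 n c (gr_sf hG0).
  - by [].
  - by rewrite (dom_G0 e).
  - by exists l, n.
exists N', e, (chain_union G0 Z); split=> //.
- split=> //.
    move=> z; apply: (chain_union_der (@dpairD M N') (@dpairM M N')) => //.
      exact: gr_sf hG0.
    exact: gr_d hG0.
  by move=> k; exists 0%N; apply: gr_a hG0 k.
- rewrite /lclosed domE => c [n Fc] dc.
  have hD := dom_subfield hG.
  have [h hh E] := @chain_pspan M (@md _ _ _ M) p (@model_dD M) (@model_dM M)
    (model_pchar M) _ (mono M) (dom G) X hD dom_der (fun i => erefl) lG n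
    (fun i _ => tx i) (transc_notin (chain_subfield hD (fun i _ => @unital_field _ _ _)) (tx n))
    c Fc dc.
  by exists h => // i; exists n.
- by move=> z Gz; exists 0%N; apply: G0_ext.
- by rewrite domE; exists 1%N; apply: (@adj_gen _ (dom G) (X 0%N)); apply: dom_subfield.
Qed.

(** The partner of x solves the transferred equation and is generic below order n. Separability
    makes the chain with n+1 generators closed under the derivation. *)
Lemma ext_sep n f : (forall i, (i < n)%N -> transc (chain (dom G) X i) (X i)) ->
  sep_alg (dom G) X n f ->
  exists (N' : model) (e : elem_ext N N') (G' : M * N' -> Prop),
  [/\ graph G', extends e G' & dom G' x].
Proof.
move=> tx hf.
have [c [b [hc b0 bf sc]]] := sep_equation hG hf.
have [N' [e [y [fy ind]]]] := elem_generic_sep hp hmu sc.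
pose G0 := transport (elem_id M) e G.
pose Z i : M * N' := (X i, iter i (@md _ _ _ N') y).
have hG0 : graph G0 by apply: graph_transport.
have uz := Z_unital tx ind.
have [uzn [g [hg gz g'z]]] := sep_unital hG hf hc b0 bf fy uz.
have uz' i : (i < n.+1)%N -> unital_at (chain G0 Z i) (Z i).
  by rewrite ltnS leq_eqVlt => /orP[/eqP->|/uz].
exists N', e, (chain G0 Z n.+1); split=> //.
- split.
  + by apply: chain_subfield => //; apply: gr_sf hG0.
  + exact: (chain_der_sep (@dpairD M N') (@dpairM M N') (gr_sf hG0) (gr_d hG0)
      (fun i => erefl) uz' hg gz g'z).
  + move=> k; apply: (@chain_mono _ G0 Z 0 n.+1) => //; first exact: gr_sf hG0.
    exact: gr_a hG0 k.
- move=> z Gz; apply: (@chain_mono _ G0 Z 0 n.+1) => //; first exact: gr_sf hG0.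
  exact: G0_ext.
- exists y; apply: (@chain_gen _ G0 Z 0 n.+1) => //; exact: gr_sf hG0.
Qed.

Lemma transc_or_sep_dom : lclosed G ->
  (forall n, transc (chain (dom G) X n) (X n)) \/
  exists n f, (forall i, (i < n)%N -> transc (chain (dom G) X i) (X i)) /\
    sep_alg (dom G) X n f.
Proof.
move=> lG; apply: (transc_or_sep (@model_dD M) (@model_dM M) (model_pchar M) (m := mono M)) => //.
- exact: dom_subfield.
- exact: dom_der.
- exact: model_indep.
Qed.

End OneElement.
End Game.

Section Extension.

Variables (p eps : nat) (mu : 'I_(p ^ eps) -> {ffun 'I_eps -> 'I_p}).
Hypothesis hp : prime p.
Hypothesis hmu : bijective mu.

Local Notation model := (model mu).

Lemma graph_embed (M N M' N' : model) (e : elem_ext M M') (e' : elem_ext N N')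
    (G : M * N -> Prop) (G' : M' * N' -> Prop) c :
  (forall z, G z -> G' (e z.1, e' z.2)) -> dom G c -> dom G' (e c).
Proof. by move=> GG' [l /GG' H]; exists (e' l). Qed.

(* Two elements x, y are replaced by u = x + t y, for t differentially transcendental:
   either u is differentially transcendental over the current field, so that it may
   be adjoined, or y is a differential rational function of u. *)
Theorem graph_extension (M N : model) (G : M * N -> Prop) (xs : seq M) :
  graph G -> lclosed G ->
  exists (M' N' : model) (e : elem_ext M M') (e' : elem_ext N N')
    (G' : M' * N' -> Prop),
  [/\ graph G', forall z, G z -> G' (e z.1, e' z.2) &
      forall x, x \in xs -> dom G' (e x)].
Proof.
have [k] := ubnP (size xs); elim: k M N G xs => // k IHk M N G xs.
case: xs => [|x [|y xs]] /=; rewrite ltnS => lek gG lG.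
- by exists M, N, (elem_id M), (elem_id N), G; split=> // -[a b].
(* A single remaining element may be adjoined by [ext_sep], since the conclusion asks only for a
   graph. *)
- have H : exists (N' : model) (e : elem_ext N N') (G' : M * N' -> Prop),
      [/\ graph G', extends G e G' & dom G' x].
    case: (transc_or_sep_dom hmu x gG lG) => [tx|[n [f [tx hf]]]].
      by have [N' [e [G' [? ? ? ? _]]]] := ext_transc hp hmu gG lG tx; exists N', e, G'.
    by have [N' [e [G' [? ? ?]]]] := ext_sep hp hmu gG tx hf; exists N', e, G'.
  have [N' [e [G' [gG' ext Gx]]]] := H.
  exists M, N', (elem_id M), e, G'; split=> // x'.
  by rewrite inE => /eqP ->.
have [M1 [e1 [t ind]]] := elem_generic hp hmu M.
pose G1 := transport e1 (elem_id N) G.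
have gG1 : graph G1 by apply: graph_transport.
have lG1 : lclosed G1 by apply: lclosed_transport.
have G1e c : dom G1 c -> exists b, c = e1 b.
  by move/dom_transport => [b _ ->]; exists b.
have tT n := alg_indep_transc G1e (ind n.+1).
have [N2 [e2 [G2 [gG2 lG2 ext2 G2t domE]]]] := ext_transc hp hmu gG1 lG1 tT.
pose u := e1 x + t * e1 y.
(* Once u, t and y are in the domain, so is x = u - t y. *)
have fin (N3 M4 N4 : model) (e3 : elem_ext N2 N3) (e4 : elem_ext M1 M4)
    (e4' : elem_ext N3 N4) (G4 : M4 * N4 -> Prop) : graph G4 ->
    (forall z, G2 z -> G4 (e4 z.1, e4' (e3 z.2))) ->
    dom G4 (e4 u) -> dom G4 (e4 (e1 y)) ->
    (forall x', x' \in xs -> dom G4 (e4 (e1 x'))) ->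
    exists (M' N' : model) (e : elem_ext M M') (e' : elem_ext N N')
      (G' : M' * N' -> Prop),
    [/\ graph G', forall z, G z -> G' (e z.1, e' z.2) &
      forall x', x' \in [:: x, y & xs] -> dom G' (e x')].
  move=> gG4 ext4 Gu Gy Gxs.
  exists M4, N4, (elem_comp e4 e1), (elem_comp e4' (elem_comp e3 e2)), G4; split=> //.
    move=> z Gz; have G1z : G1 (e1 z.1, z.2) by exists z.
    exact: ext4 _ (ext2 _ G1z).
  have hD := dom_subfield (gr_sf gG4).
  move=> x'; rewrite !inE => /or3P[/eqP->|/eqP->|/Gxs] //=.
  have -> : e4 (e1 x) = e4 u - e4 t * e4 (e1 y).
    by rewrite -rmorphM -rmorphB addrK.
  apply: sfB => //; apply: sfM => //.
  by have [l /ext4 H] := G2t; exists (e4' (e3 l)).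
(* If u is differentially transcendental, adjoining it keeps the graph closed, and y with the rest
   forms a shorter list. Otherwise u itself takes the place of x and y in the list. *)
case: (transc_or_sep_dom hmu u gG2 lG2) => [tu|[n [f [tu hf]]]].
  have [N3 [e3 [G3 [gG3 lG3 ext3 G3u _]]]] := ext_transc hp hmu gG2 lG2 tu.
  have [|M4 [N4 [e4 [e4' [G4 [gG4 ext4 H4]]]]]] := IHk M1 N3 G3 (e1 y :: map e1 xs) _ gG3 lG3.
    by rewrite /= size_map.
  apply: (fin N3 M4 N4 e3 e4 e4' G4) => //.
  - by move=> z /ext3/ext4.
  - exact: graph_embed ext4 G3u.
  - by apply: H4; rewrite inE eqxx.
  - by move=> x' xx; apply: H4; rewrite inE map_f ?orbT.
have [|M4 [N4 [e4 [e4' [G4 [gG4 ext4 H4]]]]]] := IHk M1 N2 G2 (u :: map e1 xs) _ gG2 lG2.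
  by rewrite /= size_map.
have Gu : dom G4 (e4 u) by apply: H4; rewrite inE eqxx.
apply: (fin N2 M4 N4 (elem_id N2) e4 e4' G4) => //; last first.
  by move=> x' xx; apply: H4; rewrite inE map_f ?orbT.
have := hf; rewrite domE.
move/(primitive_element (@model_dD _ _ _ M1) (@model_dM _ _ _ M1) (ed e1) ind
   (dom_subfield (gr_sf gG1)) G1e); rewrite -domE.
have hD := dom_subfield (gr_sf gG4).
(* The elements that [e4] sends into the final domain form a field containing the old domain and all
   derivatives of u, hence y. *)
apply: (@chain_min _ _ (fun c => dom G4 (e4 c))).
- split.
  + by rewrite rmorph1; apply: sf1.
  + by move=> a b Ha Hb; rewrite rmorphB; apply: sfB.
  + by move=> a b Ha Hb; rewrite rmorphM; apply: sfM.
  + by move=> a Ha; rewrite fmorphV; apply: sfV.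
  + by move=> a _ a0; rewrite unitfE.
- by move=> c; apply: graph_embed ext4.
- move=> j _; elim: j => [//|j IHj] /=.
  by rewrite -(ed e4); apply: dom_der.
Qed.

End Extension.

(** * Quantifier elimination *)

Section QuantifierElimination.

Variables (p eps : nat) (mu : 'I_(p ^ eps) -> {ffun 'I_eps -> 'I_p}).
Hypothesis hp : prime p.
Hypothesis hmu : bijective mu.

Local Notation model := (model mu).
Local Notation S := (Ldl p eps).

Section Terms.

Variable n : nat.
Implicit Types t u : term S n.

Definition tzero : term S n :=
  @App S n (SZero p eps : fsym S) (fun i => Var S (False_rect _ (notF (ltn_ord i)))).
Definition tone : term S n :=
  @App S n (SOne p eps : fsym S) (fun i => Var S (False_rect _ (notF (ltn_ord i)))).
Definition tconst j : term S n :=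
  @App S n (@SConst p eps j : fsym S) (fun i => Var S (False_rect _ (notF (ltn_ord i)))).
Definition topp t : term S n := @App S n (SOpp p eps : fsym S) (fun=> t).
Definition tinv t : term S n := @App S n (SInv p eps : fsym S) (fun=> t).
Definition tdelta t : term S n := @App S n (SDelta p eps : fsym S) (fun=> t).
Definition tell k t : term S n := @App S n (@SEll p eps k : fsym S) (fun=> t).
Definition tadd t u : term S n :=
  @App S n (SAdd p eps : fsym S) (fun i => if i == ord0 :> 'I_2 then t else u).
Definition tmul t u : term S n :=
  @App S n (SMul p eps : fsym S) (fun i => if i == ord0 :> 'I_2 then t else u).

End Terms.

Section SameType.

Variables (M N : model) (n : nat) (v : 'I_n -> M) (w : 'I_n -> N).
Hypothesis same : forall phi : formula S n, qfree phi ->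
  @sat _ (mstr M) n phi v <-> @sat _ (mstr N) n phi w.

Definition term_graph (z : M * N) : Prop := exists t : term S n,
  z = (@eval _ (mstr M) n v t, @eval _ (mstr N) n w t).

(** Agreement on the equations t = 0 means that the two values of a term vanish together; this gives
    units and compatibility with the totalised inverse. *)
Lemma graph_term_graph : graph term_graph.
Proof.
have eq0 (t : term S n) : @eval _ (mstr M) n v t = 0 <-> @eval _ (mstr N) n w t = 0.
  exact: (same (phi := FEq t (tzero n))).
split.
- split.
  + by exists (tone n).
  + by move=> _ _ [t ->] [u ->]; exists (tadd t (topp u)).
  + by move=> _ _ [t ->] [u ->]; exists (tmul t u).
  + move=> _ [t ->]; exists (tinv t); rewrite /=.
    have [h1|h1] := eqVneq (@eval _ (mstr M) n v t : M) 0.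
      by have h2 := (eq0 t).1 h1; rewrite h1 h2 -[LHS]/((0 : M * N)^-1) !invr0.
    by rewrite pair_invE //=; apply/eqP => /eq0/eqP; rewrite (negbTE h1).
  + move=> _ [t ->] nz; rewrite pair_unitE /=.
    have h1 : (@eval _ (mstr M) n v t : M) != 0.
      by apply: contraNneq nz => h; have h2 := (eq0 t).1 h; rewrite h h2.
    by rewrite h1; apply/eqP => /eq0/eqP; rewrite (negbTE h1).
- by move=> _ [t ->]; exists (tdelta t).
- by move=> k; exists (tconst n k).
Qed.

(** This is where the symbols [SEll] of the language enter: the coordinates of a term value are
    again term values. *)
Lemma lclosed_term_graph : lclosed term_graph.
Proof.
move=> c [l [t [-> _]]] dc.
exists (fun k => ml k (@eval _ (mstr M) n v t : M)); last exact: model_lE.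
by move=> k; exists (ml k (@eval _ (mstr N) n w t : N)), (tell k t).
Qed.

End SameType.

(* The functions l_i are definable from the field operations once all their values
   belong to the domain, so a graph of differential fields preserves them. *)
Lemma graph_ell (M N : model) (G : M * N -> Prop) (b : M) (b' : N) :
  graph G -> G (b, b') -> (forall k, dom G (ml k b)) ->
  forall k, G (ml k b, ml k b').
Proof.
move=> gG Gb Gl; have hG := gr_sf gG; have Gd := gr_d gG Gb.
have [db|db] := eqVneq (md b) 0; last first.
  have nz : dpair (b, b') != 0 by apply: contraNneq db => /(congr1 fst) /= ->.
  have [_ /= db'] := graph_neq0 hG Gd nz.
  by move=> k; rewrite !model_l0; [apply: sf0 hG|apply/eqP|apply/eqP].
have db' : md b' = 0 by have := graph_fst0 hG Gd db; move/(congr1 snd).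
have /boolp.choice[l hl] := Gl.
have Gm k : G (mono M k, mono N k).
  have -> : (mono M k, mono N k) = \prod_(j < eps) (ma M j, ma N j) ^+ mu k j.
    apply: injective_projections.
      apply: esym; apply: etrans (rmorph_prod fst _ _ _) _.
      by apply: eq_bigr => j _; apply: (rmorphXn fst).
    apply: esym; apply: etrans (rmorph_prod snd _ _ _) _.
    by apply: eq_bigr => j _; apply: (rmorphXn snd).
  by apply: sf_prod => // j _; apply: sfX => //; apply: gr_a.
(* The first component of this element of G is b, so the second is b'. Thus the partners [l k] are
   coordinates of b', and p-independence identifies them with [ml k b']. *)
pose s : M * N := \sum_k (ml k b, l k) ^+ p * (mono M k, mono N k).
have Gs : G s by apply: sf_sum => // k _; apply: sfM => //; apply: sfX.
have s1 : s.1 = b.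
  rewrite [RHS]model_lE //; apply: etrans (rmorph_sum fst _ _ _) _.
  by apply: eq_bigr => k _; rewrite rmorphM rmorphXn.
have s2 : s.2 = \sum_k l k ^+ p * mono N k.
  apply: etrans (rmorph_sum snd _ _ _) _.
  by apply: eq_bigr => k _; rewrite rmorphM rmorphXn.
have b'E : b' = s.2.
  by apply: (graph_eq hG Gb); rewrite -s1; case: (s) Gs.
have H : \sum_k (l k - ml k b') ^+ p * mono N k = 0.
  have Fr (x y : N) : (x - y) ^+ p = x ^+ p - y ^+ p.
    exact: (rmorphB (pFrobenius_aut (model_pchar N))).
  under eq_bigr => k _ do rewrite Fr mulrBl.
  by rewrite sumrB -s2 -model_lE // -b'E subrr.
move=> k; have /eqP := model_indep hmu H k.
by rewrite subr_eq0 => /eqP <-.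
Qed.

Section Transfer.

Variables (M : model).

(** Finitely many elements s suffice for Q, uniformly in all graphs over elementary extensions of M
    that match v with w. Finiteness is what allows [graph_extension] to supply them. *)
Definition determines (s : seq M) n (v : 'I_n -> M)
    (Q : forall N : model, ('I_n -> N) -> forall M' (e : elem_ext M M'),
      (M' * N -> Prop) -> Prop) :=
  forall (M' N : model) (e : elem_ext M M') (G : M' * N -> Prop) (w : 'I_n -> N),
  graph G -> (forall k, G (e (v k), w k)) -> (forall c, c \in s -> dom G (e c)) ->
  Q N w M' e G.

Lemma term_determined n (v : 'I_n -> M) (t : term S n) : exists s : seq M,
  determines s v (fun N w M' e G =>
    G (e (@eval _ (mstr M) n v t), @eval _ (mstr N) n w t)).
Proof.
elim: t => [k|f ts IHt]; first by exists [::] => M' N e G w _ H _; apply: H.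
have [ss hs] := boolp.choice IHt.
pose vals i := @eval _ (mstr M) n v (ts i) : M.
(* Besides the lists of the subterms, all l-values of the arguments are included, as required by
   [graph_ell]. *)
exists (flatten [seq ss i | i <- enum 'I_(arity f)] ++
  flatten [seq [seq ml k (vals i) | k <- enum 'I_(p ^ eps)] | i <- enum 'I_(arity f)]).
move=> M' N e G w gG Gv Gs; have hG := gr_sf gG.
have Gt i : G (e (vals i), @eval _ (mstr N) n w (ts i)).
  apply: hs => // c cs; apply: Gs; rewrite mem_cat; apply/orP; left.
  by apply/flattenP; exists (ss i) => //; apply: map_f; rewrite mem_enum.
have Gl i k : dom G (ml k (e (vals i))).
  rewrite el; apply: Gs; rewrite mem_cat; apply/orP; right.
  apply/flattenP; exists [seq ml k (vals i) | k <- enum 'I_(p ^ eps)].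
    by apply: (map_f (fun i => [seq ml k (vals i) | k <- enum 'I_(p ^ eps)])); rewrite mem_enum.
  by apply: (map_f (fun k => ml k (vals i))); rewrite mem_enum.
case: f ts IHt ss hs @vals Gs Gt Gl => [||||||| j|k] ts IHt ss hs vals Gs Gt Gl /=.
- by rewrite rmorph0; apply: sf0 hG.
- by rewrite rmorph1; apply: sf1 hG.
- by rewrite rmorphD; apply: (sfD hG (Gt ord0) (Gt ord_max)).
- by rewrite rmorphN; apply: (sfN hG (Gt ord0)).
- by rewrite rmorphM; apply: (sfM hG (Gt ord0) (Gt ord_max)).
- have := sfV hG (Gt ord0); rewrite fmorphV.
  have [h|h] := eqVneq (e (vals ord0), @eval _ (mstr N) n w (ts ord0)) 0.
    by have [-> ->] := h; rewrite -[(0, 0)]/(0 : M' * N) !invr0.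
  by have [h1 h2] := graph_neq0 hG (Gt ord0) h; rewrite pair_invE.
- by rewrite -ed; apply: (gr_d gG (Gt ord0)).
- by rewrite -ea; apply: gr_a.
- by rewrite -el; apply: (graph_ell gG (Gt ord0) (Gl ord0)).
Qed.

Lemma formula_determined n (phi : formula S n) (v : 'I_n -> M) : qfree phi ->
  exists s : seq M, determines s v (fun N w M' e G =>
    @sat _ (mstr M) n phi v <-> @sat _ (mstr N) n phi w).
Proof.
have cat_det (s1 s2 : seq M) m (v' : 'I_m -> M) Q1 Q2 : determines s1 v' Q1 -> determines s2 v' Q2 ->
    determines (s1 ++ s2) v' (fun N w M' e G => Q1 N w M' e G /\ Q2 N w M' e G).
  move=> h1 h2 M' N e G w gG Gv Gs; split.
    by apply: h1 => // c cs; apply: Gs; rewrite mem_cat cs.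
  by apply: h2 => // c cs; apply: Gs; rewrite mem_cat cs orbT.
elim: phi v => {n} [n t u|n|n A IHA B IHB|n A IHA B IHB|n A IHA B IHB|n A IHA|n A IHA] v //=.
- move=> _; have [s hs] := term_determined v t; have [s' hs'] := term_determined v u.
  exists (s ++ s') => M' N e G w gG Gv Gs.
  have [H1 H2] := cat_det _ _ _ _ _ _ hs hs' M' N e G w gG Gv Gs.
  have hG := gr_sf gG; split=> E.
    by apply: (graph_eq hG H1); rewrite E.
  apply: (fmorph_inj e); apply/eqP; rewrite -subr_eq0; apply/eqP.
  have := sfB hG H1 H2; rewrite E => H.
  apply: contrapT => /eqP nz.
  have [|_] := graph_neq0 hG H; last by rewrite /= subrr eqxx.
  by apply: contraNneq nz => /(congr1 fst) h; apply/eqP.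
- by move=> _; exists [::].
- move=> /andP[qA qB]; have [s hs] := IHA v qA; have [s' hs'] := IHB v qB.
  exists (s ++ s') => M' N e G w gG Gv Gs.
  by have [-> ->] := cat_det _ _ _ _ _ _ hs hs' M' N e G w gG Gv Gs.
- move=> /andP[qA qB]; have [s hs] := IHA v qA; have [s' hs'] := IHB v qB.
  exists (s ++ s') => M' N e G w gG Gv Gs.
  by have [-> ->] := cat_det _ _ _ _ _ _ hs hs' M' N e G w gG Gv Gs.
- move=> /andP[qA qB]; have [s hs] := IHA v qA; have [s' hs'] := IHB v qB.
  exists (s ++ s') => M' N e G w gG Gv Gs.
  by have [-> ->] := cat_det _ _ _ _ _ _ hs hs' M' N e G w gG Gv Gs.
Qed.

End Transfer.

Lemma same_type_exists (M N : model) n (v : 'I_n -> M) (w : 'I_n -> N)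
    (theta : formula S n.+1) : qfree theta ->
  (forall phi : formula S n, qfree phi ->
    @sat _ (mstr M) n phi v <-> @sat _ (mstr N) n phi w) ->
  @sat _ (mstr M) n (FEx theta) v -> @sat _ (mstr N) n (FEx theta) w.
Proof.
move=> qth same [x satx].
have [s hs] := formula_determined (scons x v) qth.
have [M' [N' [e [e' [G' [gG' ext Gs]]]]]] := graph_extension hp hmu (x :: s)
  (graph_term_graph same) (@lclosed_term_graph M N n v w).
have [y Gxy] : dom G' (e x) by apply: Gs; rewrite inE eqxx.
(* The witness y lives in an elementary extension of N, and elementarity brings the existential
   formula back to N. *)
apply/(esat e'); exists y.
apply/(hs M' N' e G' (scons y (fun k => e' (w k)))) => //.
- move=> k; rewrite /scons; case: (unlift _ _) => [j|//].
  by apply: (ext (v j, w j)); exists (Var S j).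
- by move=> c cs; apply: Gs; rewrite inE cs orbT.
Qed.

Definition point n := {M : model & 'I_n -> M}.

Definition holds_at n (a : point n) (phi : formula S n) :=
  @sat _ (mstr (projT1 a)) n phi (projT2 a).

(** Q is split by the truth value of the first formula. Each half is saturated under agreement on
    the remaining ones, so that induction applies; invariance of Q shows that saturation adds no
    point outside Q with the same truth value. *)
Lemma qf_definable n (s : seq (formula S n)) (Q : point n -> Prop) :
  (forall phi, List.In phi s -> qfree phi) ->
  (forall a b, (forall phi, List.In phi s -> holds_at a phi <-> holds_at b phi) ->
    Q a -> Q b) ->
  exists2 psi, qfree psi & forall a, Q a <-> holds_at a psi.
Proof.
elim: s Q => [|phi s IHs] Q qs inv.
  case: (pselect (exists a, Q a)) => [[a Qa]|nQ].
    exists (FImp (FFalse S n) (FFalse S n)) => // b; split=> _; first exact: id.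
    by apply: (inv a b _ Qa).
  by exists (FFalse S n) => // b; split=> // Qb; apply: nQ; exists b.
pose sim a b := forall phi, List.In phi s -> holds_at a phi <-> holds_at b phi.
pose Q1 a := exists b, [/\ sim b a, holds_at b phi & Q b].
pose Q2 a := exists b, [/\ sim b a, ~ holds_at b phi & Q b].
have qs' psi : List.In psi s -> qfree psi by move=> h; apply: qs; right.
have [||psi1 q1 H1] := IHs Q1 => //.
  move=> a b ab [c [ca h Qc]]; exists c; split=> // psi ps.
  by rewrite (ca _ ps); apply: ab.
have [||psi2 q2 H2] := IHs Q2 => //.
  move=> a b ab [c [ca h Qc]]; exists c; split=> // psi ps.
  by rewrite (ca _ ps); apply: ab.
exists (FOr (FAnd phi psi1) (FAnd (FImp phi (FFalse S n)) psi2)).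
  by rewrite /= q1 q2 (qs phi) //; left.
move=> a; split=> [Qa|].
  case: (pselect (holds_at a phi)) => h; [left|right]; split=> //.
    by apply/H1; exists a; split.
  by apply/H2; exists a; split.
case=> [[h /H1[b [ba hb Qb]]]|[h /H2[b [ba hb Qb]]]]; apply: (inv b a _ Qb) => psi [<-|/ba //].
  by split.
by split=> [/hb|/h].
Qed.

(** Compactness: otherwise every finite list of quantifier-free formulas admits two points that
    agree on it but not on the existential formula. Their ultraproducts agree on all quantifier-free
    formulas, against [same_type_exists]. *)
Lemma exists_definable n (theta : formula S n.+1) : qfree theta ->
  exists2 psi : formula S n, qfree psi &
    forall a, holds_at a (FEx theta) <-> holds_at a psi.
Proof.
move=> qth; apply: contrapT => nex.
pose J := {phi : formula S n | qfree phi}.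
pose bad (s : seq J) (ab : point n * point n) :=
  [/\ forall phi : J, List.In phi s -> holds_at ab.1 (sval phi) <-> holds_at ab.2 (sval phi),
      holds_at ab.1 (FEx theta) & ~ holds_at ab.2 (FEx theta)].
have /boolp.choice[ab abP] : forall s, exists ab, bad s ab.
  move=> s; apply: contrapT => nbad; apply: nex.
  apply: (@qf_definable n (map sval s) (fun a => holds_at a (FEx theta))).
    by move=> phi /List.in_map_iff[[psi q] [<- _]].
  move=> a b H Ha; apply: contrapT => Hb; apply: nbad; exists (a, b); split=> //.
  by move=> phi ps; apply: H; apply: List.in_map.
have [U [hU UJ]] := ultrafilter_seq J.
pose MA s := projT1 (ab s).1; pose MB s := projT1 (ab s).2.
have LA phi := Los hp hmu hU (M := MA) phi (fun k s => projT2 (ab s).1 k).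
have LB phi := Los hp hmu hU (M := MB) phi (fun k s => projT2 (ab s).2 k).
have : @sat _ (mstr (up_model hp hmu hU MB)) n (FEx theta)
    (fun k => cls hU (fun s => projT2 (ab s).2 k)).
  apply: (@same_type_exists (up_model hp hmu hU MA) (up_model hp hmu hU MB) n
    (fun k => cls hU (fun s => projT2 (ab s).1 k))) => //.
    move=> phi q; rewrite LA LB; apply: (uf_iff hU).
    by apply: ufS (UJ (exist _ phi q)) => // s /(let: And3 h _ _ := abP s in h).
  by apply/LA; apply: (ufT hU) => s; case: (abP s).
move/LB => H; apply: (uf0 hU); apply: ufS H => // s.
by case: (abP s).
Qed.

Lemma qe_models n (phi : formula S n) :
  exists2 psi : formula S n, qfree psi & forall a, holds_at a phi <-> holds_at a psi.
Proof.
elim: phi => {n} [n t u|n|n A [A' qA HA] B [B' qB HB]|n A [A' qA HA] B [B' qB HB]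
  |n A [A' qA HA] B [B' qB HB]|n A [A' qA HA]|n A [A' qA HA]].
- by exists (FEq t u).
- by exists (FFalse S n).
- exists (FAnd A' B'); first by rewrite /= qA.
  by move=> a; rewrite /holds_at /= -!/(holds_at a _) HA HB.
- exists (FOr A' B'); first by rewrite /= qA.
  by move=> a; rewrite /holds_at /= -!/(holds_at a _) HA HB.
- exists (FImp A' B'); first by rewrite /= qA.
  by move=> a; rewrite /holds_at /= -!/(holds_at a _) HA HB.
- have [|psi q H] := @exists_definable n (FImp A' (FFalse S n.+1)).
    by rewrite /= qA.
  exists (FImp psi (FFalse S n)); first by rewrite /= q.
  move=> a; have {}H := H a; split=> [h /H[x nx]|h x].
    by apply: nx; apply/(HA (existT _ (projT1 a) (scons x (projT2 a)))); apply: h.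
  apply/(HA (existT _ (projT1 a) (scons x (projT2 a)))); apply: contrapT => nx.
  by apply: h; apply/H; exists x.
- have [psi q H] := exists_definable qA.
  exists psi => // a; rewrite -H; split=> -[x hx]; exists x.
    by apply/(HA (existT _ (projT1 a) (scons x (projT2 a)))).
  by apply/(HA (existT _ (projT1 a) (scons x (projT2 a)))).
Qed.

End QuantifierElimination.

(** A model of the theory is any structure satisfying its sentences, so an equivalence of formulas
    reaches it only in the form of a sentence. *)
Fixpoint universal_closure (S : signature) n : formula S n -> sentence S :=
  if n is k.+1 then fun phi => universal_closure (FAll phi) else id.

Lemma sat_universal_closure (S : signature) (M : structure S) n (phi : formula S n) v0 :
  sat (M := M) (universal_closure phi) v0 <-> forall v : 'I_n -> M, sat phi v.
Proof.
elim: n phi => [|n IHn] phi /=.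
  have e v : v = v0 by apply/funext => -[].
  by split=> [h v|h]; [rewrite (e v)|apply: h].
rewrite IHn; split=> [h v|h v x]; last exact: h.
have := h (fun i => v (lift ord0 i)) (v ord0); congr sat.
apply/funext => i; rewrite /scons; case: unliftP => [j|] -> //.
Qed.

Theorem theorem6p3 (p eps : nat) (mu : 'I_(p ^ eps) -> {ffun 'I_eps -> 'I_p})
    (hp : prime p) (hmu : bijective mu) :
  has_QE (SDCFl mu).
Proof.
move=> n phi; have [psi q H] := qe_models hp hmu phi.
exists psi; split=> // M modM v.
pose chi := FAnd (FImp phi psi) (FImp psi phi).
have /modM hM : SDCFl mu (universal_closure chi).
  move=> K d a l hDF hSD v0; apply/sat_universal_closure => w.
  by have [h1 h2] := H (existT _ (Model hDF hSD) w); split.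
have v0 : 'I_0 -> M by case.
by have /sat_universal_closure/(_ v)[] := hM v0.
Qed.
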